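(* Let $T\in\mathbb{R}_+^{N_1\times\cdots\times N_m}$ be an entrywise nonnegative tensor, $\boldsymbol{\sigma}=\{\sigma_i\}_{i=1}^d$ a shape partition of $T$ and $p=(p_1,\ldots,p_d)\in(1,\infty)^d$. Let $r=r^{(\boldsymbol{\sigma},p)}(T)$, $F=F^{(\boldsymbol{\sigma},p)}$, $G=G^{(\boldsymbol{\sigma},p)}$, $A$, $b$, $\mu_b$, $\overline{\mathrm{cw}}$, $\underline{\mathrm{cw}}$ be as defined in the context. Assume that $T$ is $\boldsymbol{\sigma}$-strictly nonnegative, that $T$ has a positive $(\boldsymbol{\sigma},p)$-eigenvector $u$, and that $\rho(A)\le1$. For arbitrary $x^0,y^0\in\mathcal{K}_{++}$ define, for $k=0,1,2,\ldots$, $$x^{k+1}=\Big(\tfrac{F_1(x^k)}{\|F_1(x^k)\|_{p_1}},\ldots,\tfrac{F_d(x^k)}{\|F_d(x^k)\|_{p_d}}\Big),\qquad y^{k+1}=\Big(\tfrac{G_1(y^k)}{\|G_1(y^k)\|_{p_1}},\ldots,\tfrac{G_d(y^k)}{\|G_d(y^k)\|_{p_d}}\Big),$$ and for $k\ge1$ let $$\underline\xi_k=\underline{\mathrm{cw}}(F,x^k),\quad \overline\xi_k=\overline{\mathrm{cw}}(F,x^k),\quad \underline\zeta_k=\big(\underline{\mathrm{cw}}(G,y^k)\big)^2,\quad \overline\zeta_k=\big(\overline{\mathrm{cw}}(G,y^k)\big)^2.$$ Then: (i) If $\omega\in\{\xi,\zeta\}$, then for all $k=1,2,\ldots$ $$\underline\omega_k\le\underline\omega_{k+1}\le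 r\le\overline\omega_{k+1}\le\overline\omega_k,$$ and for every $\varepsilon>0$, if $\overline\omega_k-\underline\omega_k<\varepsilon$, then $\Big|\frac{\underline\omega_k+\overline\omega_k}{2}-r\Big|\le\frac{\varepsilon}{2}$. (ii) If $\rho(A)<1$, then $\lim_{k\to\infty}x^k=u$ and $$\mu_b(x^k,u)\le\Big(\frac{\mu_b(x^1,x^0)}{1-\rho(A)}\Big)\rho(A)^k\qquad\forall k=1,2,\ldots$$ (iii) If $T$ is $\boldsymbol{\sigma}$-weakly irreducible, then $\lim_{k\to\infty}y^k=u$.
   Context: Write $[N]=\{1,\ldots,N\}$ and $\mathbb{R}_+=[0,\infty)$. For a tensor $T\in\mathbb{R}^{N_1\times\cdots\times N_m}$ let $f_T(z_1,\ldots,z_m)=\sum_{j_1\in[N_1],\ldots,j_m\in[N_m]}T_{j_1,\ldots,j_m}z_{1,j_1}\cdots z_{m,j_m}$ for $z_i\in\mathbb{R}^{N_i}$, and let $\mathcal{T}_{i,j_i}(z_1,\ldots,z_m)=\partial f_T/\partial z_{i,j_i}$, $\mathcal{T}_i=(\mathcal{T}_{i,1},\ldots,\mathcal{T}_{i,N_i})$. Shape partition: $\boldsymbol{\sigma}=\{\sigma_i\}_{i=1}^d$ is a shape partition of $T$ if it is a partition of $[m]$ into nonempty sets such that $N_j=N_{j'}$ whenever $j,j'\in\sigma_i$ for some $i$, and moreover (a) for every $i\in[d-1]$, $j\in\sigma_i$, $k\in\sigma_{i+1}$ one has $j\le k$; (b) if $d>1$, $|\sigma_i|\le|\sigma_{i+1}|$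 for every $i\in[d-1]$. Put $\nu_i=|\sigma_i|$, $s_i=\min\sigma_i$, $n_i=N_{s_i}$. For $x=(x_1,\ldots,x_d)\in\mathbb{R}^{n_1}\times\cdots\times\mathbb{R}^{n_d}$ let $x^{[\boldsymbol{\sigma}]}=(x_1,\ldots,x_1,\ldots,x_d,\ldots,x_d)$ with $x_i$ repeated $\nu_i$ times. Let $\mathcal{I}^{\boldsymbol{\sigma}}=\bigcup_{i=1}^d\{i\}\times[n_i]$. Cones: $\mathcal{K}_+=\mathbb{R}_+^{n_1}\times\cdots\times\mathbb{R}_+^{n_d}$ and $\mathcal{K}_{++}$ is its interior; ''positive'' means in $\mathcal{K}_{++}$. Eigenpairs: $(\lambda,x)\in\mathbb{R}\times(\mathbb{R}^{n_1}\times\cdots\times\mathbb{R}^{n_d})$ is a $(\boldsymbol{\sigma},p)$-eigenpair of $T$ (with $\lambda$ a $(\boldsymbol{\sigma},p)$-eigenvalue and $x$ a $(\boldsymbol{\sigma},p)$-eigenvector) if $\mathcal{T}_{s_i}(x^{[\boldsymbol{\sigma}]})=\lambda\psi_{p_i}(x_i)$ and $\|x_i\|_{p_i}=1$ for all $i\in[d]$, where $\psi_q(v)$ has entries $|v_j|^{q-1}\mathrm{sign}(v_j)$, $\mathrm{sign}(0)=0$. The $(\boldsymbol{\sigma},p)$-spectral radius is $r^{(\boldsymbol{\sigma},p)}(T)=\sup\{|\lambda|:\lambda\text{ is a }(\boldsymbol{\sigma},p)\text{-eigenvalue of }T\}$. Maps: $F=F^{(\boldsymbol{\sigma},p)}:\mathcal{K}_+\to\mathcal{K}_+$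 has components $F_{i,j_i}(x)=\big(\mathcal{T}_{s_i,j_i}(x^{[\boldsymbol{\sigma}]})\big)^{p_i'-1}$, $p_i'=p_i/(p_i-1)$, and $G=G^{(\boldsymbol{\sigma},p)}:\mathcal{K}_+\to\mathcal{K}_+$ has components $G_{i,j_i}(x)=\sqrt{x_{i,j_i}F_{i,j_i}(x)}$, for $(i,j_i)\in\mathcal{I}^{\boldsymbol{\sigma}}$; $F_i=(F_{i,1},\ldots,F_{i,n_i})$, $G_i=(G_{i,1},\ldots,G_{i,n_i})$. The homogeneity matrix of $F$ is $A=\mathrm{diag}(p_1'-1,\ldots,p_d'-1)(\mathbf{1}\nu^\top-I)\in\mathbb{R}_+^{d\times d}$, where $\nu=(\nu_1,\ldots,\nu_d)^\top$ and $\mathbf{1}$ is the all-ones vector; $\rho(A)$ is its spectral radius, and $b\in\mathbb{R}^d$ is the unique entrywise positive vector with $A^\top b=\rho(A)b$, $\sum_{i=1}^d b_i=1$. Let $\gamma=\frac{\sum_{i}b_ip_i'}{\sum_{i}b_ip_i'-1}$. For $H\in\{F,G\}$ and $x\in\mathcal{K}_{++}$: $\overline{\mathrm{cw}}(H,x)=\prod_{i=1}^d\big(\max_{j_i\in[n_i]}\frac{H_{i,j_i}(x)}{x_{i,j_i}}\big)^{(\gamma-1)b_i}$ and $\underline{\mathrm{cw}}(H,x)=\prod_{i=1}^d\big(\min_{j_i\in[n_i]}\frac{H_{i,j_i}(x)}{x_{i,j_i}}\big)^{(\gamma-1)b_i}$. Weighted Hilbert metric: $\mu_b(x,y)=\sum_{i=1}^d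 b_i\ln\Big(\max_{j_i,l_i\in[n_i]}\frac{x_{i,j_i}\,y_{i,l_i}}{y_{i,j_i}\,x_{i,l_i}}\Big)$ for $x,y\in\mathcal{K}_{++}$. Let $M$ be the square matrix indexed by $\mathcal{I}^{\boldsymbol{\sigma}}$ with $M_{(i,t_i),(k,l_k)}=\frac{\partial}{\partial x_{k,l_k}}\mathcal{T}_{s_i,t_i}(x^{[\boldsymbol{\sigma}]})\big|_{x=\mathbf{1}}$. $T$ is $\boldsymbol{\sigma}$-strictly nonnegative if $M$ has at least one nonzero entry in each row, and $\boldsymbol{\sigma}$-weakly irreducible if $M$ is irreducible. *)

(* Defs.v *)
From HB Require Import structures.
From mathcomp Require Import all_boot all_order all_algebra.
From mathcomp Require Import complex.
From mathcomp Require Import all_classical all_reals all_analysis.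

Set Implicit Arguments.
Unset Strict Implicit.
Unset Printing Implicit Defensive.

Import Order.TTheory GRing.Theory Num.Theory.
Import numFieldNormedType.Exports.

Local Open Scope classical_set_scope.
Local Open Scope ring_scope.

Definition bvec (R : realType) (d : nat) (n : 'I_d -> nat) : topologicalType :=
  prod_topology (fun i : 'I_d => 'rV[R]_(n i)).

Definition Kplus (R : realType) (d : nat) (n : 'I_d -> nat) : set (bvec R n) :=
  [set x | forall i j, 0 <= x i ord0 j].

Definition Kpp (R : realType) (d : nat) (n : 'I_d -> nat) : set (bvec R n) :=
  interior (@Kplus R d n).

Lemma coord_continuous_bvec (R : realType) (d : nat) (n : 'I_d -> nat)
    (i : 'I_d) (j : 'I_(n i)) :
  continuous (fun x : bvec R n => x i ord0 j).
Proof.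
move=> x; apply: (@continuous_comp (bvec R n) 'rV[R]_(n i) R
  (fun x => x i) (fun v => v ord0 j)).
  exact: (@proj_continuous _ (fun i : 'I_d => 'rV[R]_(n i)) i x).
exact: coord_continuous.
Qed.

Lemma KppE (R : realType) (d : nat) (n : 'I_d -> nat) (x : bvec R n) :
  Kpp x <-> forall i j, 0 < x i ord0 j.
Proof.
split=> [xK i j|xpos].
  pose h (t : R) : bvec R n := dfwith x i (x i + t *: delta_mx ord0 j).
  have h0 : h 0 = x.
    by rewrite /h scale0r addr0; apply: functional_extensionality_dep => k;
       case: dfwithP.
  have hc : {for 0, continuous h}.
    apply: (@continuous_comp R 'rV[R]_(n i) (bvec R n)
      (fun t => x i + t *: delta_mx ord0 j) (dfwith x i)).
      apply: (@cvgD _ _ _ _ _ (fun=> x i)); first exact: cvg_cst.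
      by apply: cvgZr_tmp; exact: cvg_id.
    exact: (@dfwith_continuous _ (fun i : 'I_d => 'rV[R]_(n i)) x i).
  have : nbhs (0 : R) (h @^-1` (@Kplus R d n)) by apply: hc; rewrite h0.
  case/nbhs_ballP => e /= e0 /(_ (- (e / 2))).
  rewrite /ball /= sub0r opprK gtr0_norm ?divr_gt0// ltr_pdivrMr// ltr_pMr//.
  rewrite (ltrDl 1 1 : (1 < 2) = _) ltr01 => /(_ isT i j).
  rewrite /h dfwithin !mxE !eqxx mulr1 subr_ge0; apply: lt_le_trans.
  by rewrite divr_gt0.
suff : \forall y \near x, forall ij : {i : 'I_d & 'I_(n i)},
    0 <= (y : bvec R n) (tag ij) ord0 (tagged ij).
  by apply: filterS => y yP i j; exact: yP (Tagged (fun i => 'I_(n i)) j).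
apply: (@filter_forall (bvec R n) {i : 'I_d & 'I_(n i)} (fun ij y => 0 <= y (tag ij) ord0 (tagged ij)) (nbhs x) (nbhs_filter x)) => -[i j] /=.
have := @coord_continuous_bvec R d n i j x.
move=> /(_ [set t | 0 <= t]); apply.
by apply: filterS (lt_nbhsr (xpos i j)) => t; exact: ltW.
Qed.

Definition partial (R : realType) (d : nat) (n : 'I_d -> nat)
    (f : bvec R n -> R) (i : 'I_d) (j : 'I_(n i)) (x : bvec R n) : R :=
  derive1 (fun t : R => f (dfwith x i (x i + t *: delta_mx ord0 j))) 0.

Definition tensor (R : realType) (m : nat) (N : 'I_m -> nat) : Type :=
  {dffun forall j : 'I_m, 'I_(N j)} -> R.

Definition tform (R : realType) (m : nat) (N : 'I_m -> nat) (T : tensor R N)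
    (z : bvec R N) : R :=
  \sum_(J : {dffun forall j : 'I_m, 'I_(N j)}) T J * \prod_(j < m) z j ord0 (J j).

Definition tgrad (R : realType) (m : nat) (N : 'I_m -> nat) (T : tensor R N)
    (i : 'I_m) (z : bvec R N) : 'rV[R]_(N i) :=
  \row_j partial (tform T) j z.

Record shape_partition (m : nat) (N : 'I_m -> nat) (d : nat) := ShapePartition {
  block : 'I_d -> {set 'I_m};
  block_inj : injective block;
  block_partition : finset.partition [set block i | i : 'I_d]%SET [set: 'I_m]%SET;
  block_dim : forall (i : 'I_d) (j j' : 'I_m),
    j \in block i -> j' \in block i -> N j = N j';
  block_le : forall (i i' : 'I_d) (j k : 'I_m), (i' = i.+1 :> nat) ->
    j \in block i -> k \in block i' -> (j <= k)%N;
  block_card : forall i i' : 'I_d, (i' = i.+1 :> nat) ->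
    (#|block i| <= #|block i'|)%N
}.

Section ShapePartition.
Context {m : nat} {N : 'I_m -> nat} {d : nat} (sigma : shape_partition N d).

Lemma block_nonempty (i : 'I_d) : exists j : 'I_m, j \in block sigma i.
Proof.
have /and3P[_ _ no0] := block_partition sigma.
have [E|//] := set_0Vmem (block sigma i); last by case=> j; exists j.
by case/negP: no0; rewrite -E; apply/imsetP; exists i.
Qed.

Lemma block_cover (j : 'I_m) : exists i : 'I_d, j \in block sigma i.
Proof.
have /and3P[/eqP cov _ _] := block_partition sigma.
have : j \in finset.cover [set block sigma i | i : 'I_d]%SET by rewrite cov inE.
by case/bigcupP => B /imsetP[i _ ->] ji; exists i.
Qed.

Definition nu (i : 'I_d) : nat := #|block sigma i|.

Definition smin (i : 'I_d) : 'I_m :=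
  [arg min_(j < xchoose (block_nonempty i) in block sigma i) (j : nat)]%N.

Definition sdim (i : 'I_d) : nat := N (smin i).

Definition block_of (j : 'I_m) : 'I_d := xchoose (block_cover j).

Lemma sdim_block_of (j : 'I_m) : sdim (block_of j) = N j.
Proof.
apply: (@block_dim _ _ _ sigma (block_of j)); last exact: (xchooseP (block_cover j)).
by rewrite /smin; case: arg_minnP => //; exact: (xchooseP (block_nonempty _)).
Qed.

(* x^[sigma]; the cast identifies R^(n_i) with R^(N_j) for j in sigma_i. *)
Definition spread (R : realType) (x : bvec R sdim) : bvec R N :=
  fun j => castmx (erefl, sdim_block_of j) (x (block_of j)).

End ShapePartition.

Definition pnorm (R : realType) (n : nat) (q : R) (v : 'rV[R]_n) : R :=
  (\sum_j `|v ord0 j| `^ q) `^ q^-1.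

Definition psi (R : realType) (n : nat) (q : R) (v : 'rV[R]_n) : 'rV[R]_n :=
  \row_j (`|v ord0 j| `^ (q - 1) * Num.sg (v ord0 j)).

Definition conj_exp (R : realType) (q : R) : R := q / (q - 1).

Section TensorSpectrum.
Context {R : realType} {m : nat} {N : 'I_m -> nat} {d : nat}.
Context (sigma : shape_partition N d) (p : 'I_d -> R) (T : tensor R N).

Definition eigenpair (lambda : R) (x : bvec R (sdim sigma)) : Prop :=
  forall i : 'I_d,
    tgrad T (smin sigma i) (spread x) = lambda *: psi (p i) (x i) /\
    pnorm (p i) (x i) = 1.

Definition teigenvalue (lambda : R) : Prop := exists x, eigenpair lambda x.

Definition teigenvector (x : bvec R (sdim sigma)) : Prop :=
  exists lambda, eigenpair lambda x.

Definition tspectral_radius : R := sup [set `|lambda| | lambda in teigenvalue].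

(* Total extensions of the maps on K_+: with powR and Num.sqrt the formulas
   have their usual meaning on nonnegative arguments, the only ones arising
   when T is nonnegative and x lies in K_+. *)
Definition Fmap (x : bvec R (sdim sigma)) : bvec R (sdim sigma) :=
  fun i => \row_j (tgrad T (smin sigma i) (spread x) ord0 j
                     `^ (conj_exp (p i) - 1)).

Definition Gmap (x : bvec R (sdim sigma)) : bvec R (sdim sigma) :=
  fun i => \row_j Num.sqrt (x i ord0 j * Fmap x i ord0 j).

Definition power_iter (H : bvec R (sdim sigma) -> bvec R (sdim sigma))
    (x0 : bvec R (sdim sigma)) (k : nat) : bvec R (sdim sigma) :=
  iter k (fun x i => (pnorm (p i) (H x i))^-1 *: H x i) x0.

End TensorSpectrum.

Section Structure.
Context {R : realType} {m : nat} {N : 'I_m -> nat} {d : nat}.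
Context (sigma : shape_partition N d) (T : tensor R N).

Definition Isigma : finType := {i : 'I_d & 'I_(sdim sigma i)}.

Definition Mmat (a c : Isigma) : R :=
  partial
    (fun x : bvec R (sdim sigma) =>
       tgrad T (smin sigma (tag a)) (spread x) ord0 (tagged a))
    (tagged c) (fun i => const_mx 1).

(* No simultaneous permutation of rows and columns brings B to a block
   triangular form with nontrivial diagonal blocks. *)
Definition irreducible (I : finType) (B : I -> I -> R) : Prop :=
  forall S : {set I}, S != finset.set0 -> S != [set: I]%SET ->
    exists a c, [/\ a \in S, c \notin S & B a c != 0].

Definition strictly_nonnegative : Prop := forall a, exists c, Mmat a c != 0.

Definition weakly_irreducible : Prop := irreducible Mmat.

End Structure.

Definition mx_spectral_radius (R : realType) (d : nat) (B : 'M[R]_d) : R :=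
  sup [set ComplexField.Normc.normc z | z in
         [set z : R[i] | eigenvalue (map_mx (real_complex R) B) z]].

Definition homogeneity_mx (R : realType) (m : nat) (N : 'I_m -> nat) (d : nat)
    (sigma : shape_partition N d) (p : 'I_d -> R) : 'M[R]_d :=
  diag_mx (\row_i (conj_exp (p i) - 1)) *m
    ((const_mx 1 : 'cV[R]_d) *m (\col_i (nu sigma i)%:R)^T - 1%:M).

(* For B the homogeneity matrix (irreducible if d > 1) this determines b. *)
Definition left_perron_vector (R : realType) (d : nat) (B : 'M[R]_d)
    (b : 'cV[R]_d) : Prop :=
  [/\ forall i, 0 < b i ord0,
      B^T *m b = mx_spectral_radius B *: b
    & \sum_i b i ord0 = 1].

(* Maximum and minimum of a finite nonempty family: see fmaxP and fminP. *)
Definition fmax (R : realType) (I : finType) (h : I -> R) : R := sup (range h).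
Definition fmin (R : realType) (I : finType) (h : I -> R) : R := inf (range h).

Lemma fmaxP (R : realType) (I : finType) (h : I -> R) (i0 : I) :
  (exists i, fmax h = h i) /\ (forall i, h i <= fmax h).
Proof.
have [i hi] : exists i, forall k, h k <= h i.
  by case: (arg_maxP h (erefl true : xpredT i0)) => i _ hi; exists i => k; exact: hi.
have ub : ubound (range h) (h i) by move=> _ [k _ <-].
have E : fmax h = h i.
  apply/eqP; rewrite eq_le ge_sup//=; last by exists (h i0); exists i0.
  by apply: ub_le_sup; [exists (h i)|exists i].
by split; [exists i|move=> k; rewrite E].
Qed.

Lemma fminP (R : realType) (I : finType) (h : I -> R) (i0 : I) :
  (exists i, fmin h = h i) /\ (forall i, fmin h <= h i).
Proof.
have [i hi] : exists i, forall k, h i <= h k.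
  by case: (arg_minP h (erefl true : xpredT i0)) => i _ hi; exists i => k; exact: hi.
have lb : lbound (range h) (h i) by move=> _ [k _ <-].
have E : fmin h = h i.
  apply/eqP; rewrite eq_le lb_le_inf//=; last by exists (h i0); exists i0.
  by rewrite andbT; apply: ge_inf; [exists (h i)|exists i].
by split; [exists i|move=> k; rewrite E].
Qed.

Section CollatzWielandt.
Context {R : realType} {d : nat} {n : 'I_d -> nat}.
Context (p : 'I_d -> R) (b : 'cV[R]_d).

Definition gamma : R :=
  (\sum_i b i ord0 * conj_exp (p i)) / (\sum_i b i ord0 * conj_exp (p i) - 1).

Definition cw_upper (H : bvec R n -> bvec R n) (x : bvec R n) : R :=
  \prod_(i < d) (fmax (fun j => H x i ord0 j / x i ord0 j))
                  `^ ((gamma - 1) * b i ord0).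

Definition cw_lower (H : bvec R n -> bvec R n) (x : bvec R n) : R :=
  \prod_(i < d) (fmin (fun j => H x i ord0 j / x i ord0 j))
                  `^ ((gamma - 1) * b i ord0).

Definition hilbert_metric (x y : bvec R n) : R :=
  \sum_(i < d) b i ord0 *
    ln (fmax (fun jl : 'I_(n i) * 'I_(n i) =>
          (x i ord0 jl.1 * y i ord0 jl.2) / (y i ord0 jl.1 * x i ord0 jl.2))).

End CollatzWielandt.

(* Main.v *)
Require Import Defs.
From HB Require Import structures.
From mathcomp Require Import all_boot all_order all_algebra.
From mathcomp Require Import complex.
From mathcomp Require Import all_classical all_reals all_analysis.
From mathcomp Require Import ring lra.

Import Order.TTheory GRing.Theory Num.Theory.
Import numFieldNormedType.Exports.

Local Open Scope classical_set_scope.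
Local Open Scope ring_scope.

(** Write [lg x] for the coordinatewise logarithm of a positive vector. The map
    F is order preserving and multi-homogeneous with degree matrix A, so that in
    logarithms
      [lg x <= a + lg y] implies [lg (F x) <= A a + lg (F y)],
    where [a] has one entry per block. The map G averages [lg x] and
    [lg (F x)], so it satisfies the same implication with (1 + A)/2 in place of
    A. Both matrices have b as a left eigenvector, for the eigenvalues rho and
    (1 + rho)/2, neither of which exceeds 1. The argument is carried out once
    for a map H with such a matrix (record [multihomogeneous]) and its
    normalization [step], and applied to F and to G.

    Summing the implication over the blocks with the weights b replaces A by
    the scalar rho ([left_eigen_sum]). Applied to the extremal ratios of two
    vectors this gives the contraction by rho in the weighted Hilbert metric
    ([step_contract]), hence part (ii) by the usual fixed point estimate
    ([hilbert_iter], [contracting_iter_cvg]). Applied to x and its image it gives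
    the monotonicity of the Collatz-Wielandt numbers ([cw_upper_step],
    [cw_lower_step]); when rho < 1 the surplus factor is controlled because x is
    normalized. Applied to x and u it places their value at u between them
    ([cw_upper_eigen], [cw_lower_eigen]). For F this value is the eigenvalue of
    u, for G its square root. The same comparison of |v| with u, for an
    arbitrary eigenvector v, shows that this eigenvalue is the spectral radius
    ([eigenvalue_le]), which completes part (i).

    For part (iii) only nonexpansiveness is left when rho = 1. The orbit of G
    stays in a bounded part of the positive cone, so it has a positive cluster
    point z, and the distance from z to u is unchanged by the normalized map
    ([irreducible_cvg]). An unchanged distance forces each coordinate that is
    maximal for [lg (step G z) - lg u] to depend only on coordinates maximal
    for [lg z - lg u] ([argmax_step]). G depends on x itself as well as on F x,
    so the sets of maximal coordinates decrease along the orbit of z, and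
    irreducibility makes them decrease strictly until they contain all
    coordinates, that is, until the orbit of z has reached u. *)

(** * The p-norm on positive vectors *)

Section PNorm.
Context {R : realType} {n : nat} {q : R}.
Hypothesis q_gt0 : 0 < q.
Implicit Types v w : 'rV[R]_n.

Lemma pnormZ (c : R) v : 0 <= c -> pnorm q (c *: v) = c * pnorm q v.
Proof.
move=> c0; rewrite /pnorm.
under eq_bigr do rewrite mxE normrM (ger0_norm c0) powRM//.
rewrite -mulr_sumr powRM ?powR_ge0 -?powRrM ?mulfV ?gt_eqF ?powRr1//.
by apply: sumr_ge0 => j _; exact: powR_ge0.
Qed.

Lemma pnorm_le (c : R) v w : 0 <= c ->
  (forall j, `|v ord0 j| <= c * `|w ord0 j|) -> pnorm q v <= c * pnorm q w.
Proof.
move=> c0 vw; rewrite -(pnormZ c w c0) /pnorm.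
apply: ge0_ler_powR; rewrite ?invr_ge0 ?nnegrE ?(ltW q_gt0)//.
- by apply: sumr_ge0 => j _; exact: powR_ge0.
- by apply: sumr_ge0 => j _; exact: powR_ge0.
- apply: ler_sum => j _; rewrite ge0_ler_powR ?nnegrE ?(ltW q_gt0)//.
  by rewrite mxE normrM (ger0_norm c0).
Qed.

Lemma pnorm_gt0 v : (0 < n)%N -> (forall j, 0 < v ord0 j) -> 0 < pnorm q v.
Proof.
move=> n0 v0; apply: powR_gt0.
have vq j : 0 < `|v ord0 j| `^ q by rewrite powR_gt0// normr_gt0 gt_eqF.
rewrite (bigD1 (Ordinal n0))//= ltr_pwDl// sumr_ge0// => j _; exact: powR_ge0.
Qed.

Lemma pnorm_normalize v : (0 < n)%N -> (forall j, 0 < v ord0 j) ->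
  pnorm q ((pnorm q v)^-1 *: v) = 1.
Proof.
move=> n0 v0; have t0 := pnorm_gt0 v n0 v0.
by rewrite pnormZ ?mulVf ?gt_eqF// invr_ge0 ltW.
Qed.

Lemma ln_pnorm_le (a : R) v w : (0 < n)%N ->
    (forall j, 0 < v ord0 j) -> (forall j, 0 < w ord0 j) ->
    (forall j, ln (v ord0 j) <= a + ln (w ord0 j)) ->
  ln (pnorm q v) <= a + ln (pnorm q w).
Proof.
move=> n0 v0 w0 vw; rewrite -[a]expRK -lnM ?posrE ?expR_gt0 ?pnorm_gt0//.
rewrite ler_ln ?posrE ?mulr_gt0 ?expR_gt0 ?pnorm_gt0//.
apply: pnorm_le; first exact: expR_ge0.
move=> j; rewrite !gtr0_norm// -ler_ln ?posrE ?mulr_gt0 ?expR_gt0//.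
by rewrite lnM ?posrE ?expR_gt0// expRK.
Qed.

End PNorm.

(** * Convergence and cluster points *)

Lemma bvec_cvg (R : realType) (d : nat) (n : 'I_d -> nat)
    (x : nat -> bvec R n) (u : bvec R n) :
  (forall i j, (fun k => x k i ord0 j) @ \oo --> u i ord0 j) -> x @ \oo --> u.
Proof.
move=> xu.
have rowcvg i : (fun k => x k i) @ \oo --> u i.
  apply/cvg_ballP => e e0.
  have : \forall k \near \oo, forall j, ball (u i ord0 j) e (x k i ord0 j).
    apply: filter_forall => j.
    by have /cvg_ballP/(_ e e0) := xu i j.
  by apply: filterS => k hk; split=> // i' j; rewrite (ord1 i').
apply/cvg_sup => i A -[_ [[B oB <-] Bu] sBA].
apply: filterS sBA _; apply: (rowcvg i); exact: open_nbhs_nbhs.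
Qed.

(** Compactness of a box in finite dimension, with cluster points expressed in
    coordinates. *)
Lemma bounded_cluster (R : realType) (I : finType) (w : nat -> I -> R) (C : R) :
  (forall k i, `|w k i| <= C) ->
  exists z : I -> R, forall (e : R) (K : nat), 0 < e ->
    exists2 k, (K <= k)%N & forall i, `|w k i - z i| < e.
Proof.
move=> wC.
pose v k : 'rV[R]_#|I| := \row_j w k (enum_val j).
have vC : (v @ \oo) [set f : 'rV[R]_#|I| | forall j, `[- C, C]%classic (f ord0 j)].
  exists 0%N => // k _ j /=; rewrite in_itv /= mxE.
  by have := wC k (enum_val j); rewrite ler_norml.
have [z [_ zcl]] := @rV_compact R _ (fun=> `[- C, C]%classic)
  (fun=> @segment_compact R _ _) (v @ \oo) _ vC.
exists (fun i => z ord0 (enum_rank i)) => e K e0.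
have [//||y [[k /= Kk <-] [_ yz]]] := zcl [set v k | k in [set k | (K <= k)%N]] (ball z e).
- by exists K => // k /= Kk; exists k.
- exact: nbhsx_ballx.
exists k => // i; have := yz ord0 (enum_rank i).
by rewrite mxE enum_rankK /ball /= distrC.
Qed.

(** * Logarithmic coordinates and the Hilbert metric *)

Section MultihomogeneousMaps.
Context {R : realType} {d : nat} {n : 'I_d -> nat}.
Implicit Types x y z : bvec R n.

Definition positive x := forall i j, 0 < x i ord0 j.

Definition lg x i j : R := ln (x i ord0 j).

Definition lratio x y i j : R := lg x i j - lg y i j.

(** The formula is the one in the Hilbert metric, so that [hilbertE] holds by
    conversion; its value is the oscillation of [lratio x y] over block i. *)
Definition osc x y i : R :=
  ln (fmax (fun jl : 'I_(n i) * 'I_(n i) =>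
    (x i ord0 jl.1 * y i ord0 jl.2) / (y i ord0 jl.1 * x i ord0 jl.2))).

Hypothesis n_gt0 : forall i, (0 < n i)%N.

Lemma dependent_argmax (g : forall i, 'I_(n i) -> R) :
  exists j : forall i, 'I_(n i), forall i l, g i l <= g i (j i).
Proof.
have H i : exists j, forall l, g i l <= g i j.
  case: (arg_maxP (g i) (erefl true : xpredT (Ordinal (n_gt0 i)))) => j _ hj.
  by exists j => l; exact: hj.
by exists (fun i => projT1 (cid (H i))) => i; exact: (projT2 (cid (H i))).
Qed.

(** Once the maximum under the logarithm is attained at known coordinates, every
    estimate on the metric is linear arithmetic in logarithms. *)
Lemma osc_witness x y : positive x -> positive y ->
  exists jmax jmin : forall i, 'I_(n i),
    [/\ forall i l, lratio x y i l <= lratio x y i (jmax i),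
        forall i l, lratio x y i (jmin i) <= lratio x y i l
      & forall i, osc x y i = lratio x y i (jmax i) - lratio x y i (jmin i)].
Proof.
move=> x0 y0.
have [jmax jmaxP] := dependent_argmax (lratio x y).
have [jmin jminP] := dependent_argmax (fun i j => - lratio x y i j).
have E i (j l : 'I_(n i)) : ln ((x i ord0 j * y i ord0 l) / (y i ord0 j * x i ord0 l)) =
    lratio x y i j - lratio x y i l.
  rewrite ln_div ?posrE ?mulr_gt0// !lnM ?posrE// /lratio /lg; ring.
exists jmax, jmin; split=> // [i l|i]; first by rewrite -lerN2.
rewrite /osc; set f := fun jl : 'I_(n i) * 'I_(n i) => _.
have f0 jl : 0 < f jl by rewrite divr_gt0 ?mulr_gt0.
have [[[j l] fE] f_le] := fmaxP f (jmax i, jmin i).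
apply/eqP; rewrite eq_le; apply/andP; split.
  by rewrite fE /f E/= lerB// -lerN2.
by rewrite -E ler_ln ?posrE ?fE ?f0//; [rewrite -fE; exact: (f_le (_, _))|exact: (f0 (_, _))].
Qed.

Lemma osc_ub x y i j l : positive x -> positive y ->
  lratio x y i j - lratio x y i l <= osc x y i.
Proof.
move=> x0 y0; have [jM [jm [M1 m1 ->]]] := osc_witness x y x0 y0.
by rewrite lerB.
Qed.

Lemma osc_le x y i (c : R) : positive x -> positive y ->
  (forall j l, lratio x y i j - lratio x y i l <= c) -> osc x y i <= c.
Proof. by move=> x0 y0 h; have [jM [jm [_ _ ->]]] := osc_witness x y x0 y0. Qed.

Lemma osc_ge0 x y i : positive x -> positive y -> 0 <= osc x y i.
Proof.
move=> x0 y0; have := osc_ub x y i (Ordinal (n_gt0 i)) (Ordinal (n_gt0 i)) x0 y0.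
by rewrite subrr.
Qed.

Context (b : 'cV[R]_d).
Hypothesis b_gt0 : forall i, 0 < b i ord0.

Lemma hilbertE x y : hilbert_metric b x y = \sum_i b i ord0 * osc x y i.
Proof. by []. Qed.

Lemma hilbert_ge0 x y : positive x -> positive y -> 0 <= hilbert_metric b x y.
Proof.
by move=> x0 y0; apply: sumr_ge0 => i _; rewrite mulr_ge0 ?osc_ge0// ltW.
Qed.

Lemma hilbert_triangle x y z : positive x -> positive y -> positive z ->
  hilbert_metric b x z <= hilbert_metric b x y + hilbert_metric b y z.
Proof.
move=> x0 y0 z0; rewrite !hilbertE -big_split /=.
apply: ler_sum => i _; rewrite -mulrDr ler_wpM2l ?(ltW (b_gt0 _))//.
apply: osc_le => // j l.
have := osc_ub x y i j l x0 y0; have := osc_ub y z i j l y0 z0.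
rewrite /lratio; lra.
Qed.

Lemma hilbert_sym x y : positive x -> positive y ->
  hilbert_metric b x y = hilbert_metric b y x.
Proof.
move=> x0 y0; rewrite !hilbertE; apply: eq_bigr => i _; congr (_ * _).
apply/eqP; rewrite eq_le; apply/andP; split; apply: osc_le => // j l.
  have := osc_ub y x i l j y0 x0; rewrite /lratio; lra.
have := osc_ub x y i l j x0 y0; rewrite /lratio; lra.
Qed.

Lemma osc_le_hilbert x y i : positive x -> positive y ->
  osc x y i <= hilbert_metric b x y / b i ord0.
Proof.
move=> x0 y0; rewrite ler_pdivlMr// mulrC hilbertE (bigD1 i)//=.
rewrite lerDl sumr_ge0// => k _; rewrite mulr_ge0 ?osc_ge0// ltW//.
Qed.

(** * Order-preserving multi-homogeneous maps *)

(** One inequality stands for both properties of H: if H preserves the order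
    and H (e^a x) = e^(A a) H x, then x <= e^a y gives H x <= e^(A a) H y. *)
Record multihomogeneous (A : 'M[R]_d) (H : bvec R n -> bvec R n) : Prop := {
  mh_pos : forall x, positive x -> positive (H x);
  mh_le : forall x y (a : 'I_d -> R), positive x -> positive y ->
    (forall k l, lg x k l <= a k + lg y k l) ->
    forall i j, lg (H x) i j <= \sum_k A i k * a k + lg (H y) i j }.

Local Notation J := {i : 'I_d & 'I_(n i)}.

(** An edge from s to c records that coordinate s of H depends on coordinate c,
    strictly enough that slack in the inequality at c survives at s. *)
Definition strict_along (E : rel J) (A : 'M[R]_d) (H : bvec R n -> bvec R n) :=
  forall x y (a : 'I_d -> R), positive x -> positive y ->
    (forall k l, lg x k l <= a k + lg y k l) ->
  forall s c : J, E s c ->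
    lg x (tag c) (tagged c) < a (tag c) + lg y (tag c) (tagged c) ->
    lg (H x) (tag s) (tagged s) <
      \sum_k A (tag s) k * a k + lg (H y) (tag s) (tagged s).

Context (p : 'I_d -> R).
Hypothesis p_gt0 : forall i, 0 < p i.

Definition normalized x := forall i, pnorm (p i) (x i) = 1.

Definition step (H : bvec R n -> bvec R n) x : bvec R n :=
  fun i => (pnorm (p i) (H x i))^-1 *: H x i.

(** The norm is monotone and homogeneous, so one of two vectors of norm 1 is
    dominated by a multiple of the other only if the factor is at least 1. *)
Lemma normalized_ge0 x y i (a : R) :
    positive x -> positive y -> normalized x -> normalized y ->
  (forall l, lg x i l <= a + lg y i l) -> 0 <= a.
Proof.
move=> x0 y0 x1 y1 xy.
have := ln_pnorm_le (p_gt0 i) a (x i) (y i) (n_gt0 i) (x0 i) (y0 i) xy.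
by rewrite x1 y1 ln1 addr0.
Qed.

Context (A : 'M[R]_d) (H : bvec R n -> bvec R n).
Hypothesis HA : multihomogeneous A H.

Lemma step_pos x : positive x -> positive (step H x).
Proof.
move=> x0 i j; have Hx := mh_pos _ _ HA x x0.
by rewrite mxE mulr_gt0// invr_gt0 pnorm_gt0.
Qed.

(** The logarithms of the norms appear as an abstract t: one shift per block,
    which cancels in every difference within a block. *)
Lemma lg_step x : positive x -> exists t : 'I_d -> R,
  (forall i j, lg (step H x) i j = lg (H x) i j - t i) /\
  (forall i, t i = ln (pnorm (p i) (H x i))).
Proof.
move=> x0; have Hx := mh_pos _ _ HA x x0.
exists (fun i => ln (pnorm (p i) (H x i))); split=> // i j.
have t0 := pnorm_gt0 (q := p i) (H x i) (n_gt0 i) (Hx i).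
by rewrite /lg mxE mulrC ln_div ?posrE//; exact: t0.
Qed.

Lemma step_normalized x : positive x -> normalized (step H x).
Proof.
by move=> x0 i; have Hx := mh_pos _ _ HA x x0; exact: pnorm_normalize.
Qed.

Context (rho : R).
Hypothesis bA : forall k, \sum_i b i ord0 * A i k = rho * b k ord0.

Lemma left_eigen_sum (a : 'I_d -> R) :
  \sum_i b i ord0 * (\sum_k A i k * a k) = rho * \sum_k b k ord0 * a k.
Proof.
under eq_bigr do rewrite mulr_sumr.
rewrite exchange_big mulr_sumr; apply: eq_bigr => k _ /=.
under eq_bigr do rewrite mulrA.
by rewrite -mulr_suml bA mulrA.
Qed.

(** If e^c y <= x <= e^a y blockwise, then e^(A c) H y <= H x <= e^(A a) H y, so
    the oscillations a - c are multiplied by A; the normalization only shifts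
    each block and does not affect them. *)
Lemma step_contract x y : positive x -> positive y ->
  hilbert_metric b (step H x) (step H y) <= rho * hilbert_metric b x y.
Proof.
move=> x0 y0; rewrite !hilbertE.
rewrite -(left_eigen_sum (osc x y)); apply: ler_sum => i _.
rewrite ler_wpM2l ?(ltW (b_gt0 _))//.
have [jM [jm [M1 m1 oE]]] := osc_witness x y x0 y0.
pose a k := lratio x y k (jM k); pose c k := lratio x y k (jm k).
have -> : \sum_k A i k * osc x y k = \sum_k A i k * a k - \sum_k A i k * c k.
  by rewrite -sumrB; apply: eq_bigr => k _; rewrite oE mulrBr.
have up j : lg (H x) i j <= \sum_k A i k * a k + lg (H y) i j.
  apply: (mh_le _ _ HA) => // k l.
  by move: (M1 k l); rewrite -/(a k) /lratio; lra.
have lo j : lg (H y) i j <= - \sum_k A i k * c k + lg (H x) i j.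
  have -> : - \sum_k A i k * c k = \sum_k A i k * - c k.
    by rewrite -sumrN; apply: eq_bigr => k _; rewrite mulrN.
  apply: (mh_le _ _ HA) => // k l.
  by move: (m1 k l); rewrite -/(c k) /lratio; lra.
apply: osc_le => [||j l]; [exact: step_pos..|].
have [t [tE _]] := lg_step x x0; have [s [sE _]] := lg_step y y0.
rewrite /lratio !tE !sE; move: (up j) (lo l).
set X := \sum_k A i k * a k; set Y := \sum_k A i k * c k.
move: X Y => X Y; lra.
Qed.

Lemma step_fix u (theta : 'I_d -> R) : normalized u -> (forall i, 0 < theta i) ->
  (forall i, H u i = theta i *: u i) -> step H u = u.
Proof.
move=> u1 t0 Hu; apply: functional_extensionality_dep => i.
rewrite /step Hu.
by rewrite pnormZ ?(ltW (t0 i))// u1 mulr1 scalerA mulVf ?scale1r// gt_eqF.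
Qed.

(** * Collatz-Wielandt ratios along the normalized iteration *)

Lemma cw_upper_witness x : positive x ->
  exists M : 'I_d -> R,
    [/\ forall i j, lg (H x) i j - lg x i j <= M i,
        forall i, exists j, M i = lg (H x) i j - lg x i j
      & cw_upper p b H x =
          expR ((gamma p b - 1) * \sum_i b i ord0 * M i)].
Proof.
move=> x0; have Hx := mh_pos _ _ HA x x0.
have ratio_gt0 i j : 0 < H x i ord0 j / x i ord0 j by rewrite divr_gt0.
have lnE i j : ln (H x i ord0 j / x i ord0 j) = lg (H x) i j - lg x i j.
  by rewrite ln_div ?posrE.
pose f i j := H x i ord0 j / x i ord0 j.
have fP i := fmaxP (f i) (Ordinal (n_gt0 i)).
have f0 i : 0 < fmax (f i) by have [[j ->] _] := fP i; exact: ratio_gt0.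
exists (fun i => ln (fmax (f i))); split=> [i j|i|].
- by rewrite -lnE ler_ln ?posrE//; have [_] := fP i; exact.
- by have [[j jE] _] := fP i; exists j; rewrite jE -lnE.
- rewrite mulr_sumr expR_sum; apply: eq_bigr => i _.
  by rewrite mulrA /powR gt_eqF ?f0.
Qed.

Lemma cw_lower_witness x : positive x ->
  exists M : 'I_d -> R,
    [/\ forall i j, M i <= lg (H x) i j - lg x i j,
        forall i, exists j, M i = lg (H x) i j - lg x i j
      & cw_lower p b H x =
          expR ((gamma p b - 1) * \sum_i b i ord0 * M i)].
Proof.
move=> x0; have Hx := mh_pos _ _ HA x x0.
have ratio_gt0 i j : 0 < H x i ord0 j / x i ord0 j by rewrite divr_gt0.
have lnE i j : ln (H x i ord0 j / x i ord0 j) = lg (H x) i j - lg x i j.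
  by rewrite ln_div ?posrE.
pose f i j := H x i ord0 j / x i ord0 j.
have fP i := fminP (f i) (Ordinal (n_gt0 i)).
have f0 i : 0 < fmin (f i) by have [[j ->] _] := fP i; exact: ratio_gt0.
exists (fun i => ln (fmin (f i))); split=> [i j|i|].
- by rewrite -lnE ler_ln ?posrE//; have [_] := fP i; exact.
- by have [[j jE] _] := fP i; exists j; rewrite jE -lnE.
- rewrite mulr_sumr expR_sum; apply: eq_bigr => i _.
  by rewrite mulrA /powR gt_eqF ?f0.
Qed.

Hypothesis rho_le1 : rho <= 1.
Hypothesis gamma_ge1 : 0 <= gamma p b - 1.

Lemma ler_wsum (a c : 'I_d -> R) : (forall i, a i <= c i) ->
  \sum_i b i ord0 * a i <= \sum_i b i ord0 * c i.
Proof. by move=> ac; apply: ler_sum => i _; rewrite ler_wpM2l ?(ltW (b_gt0 _)). Qed.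

Lemma wsumD (a c : 'I_d -> R) : \sum_i b i ord0 * (a i + c i) =
  \sum_i b i ord0 * a i + \sum_i b i ord0 * c i.
Proof. by rewrite -big_split; apply: eq_bigr => i _; rewrite mulrDr. Qed.

Lemma wsumN (a : 'I_d -> R) :
  \sum_i b i ord0 * - a i = - \sum_i b i ord0 * a i.
Proof. by rewrite -sumrN; apply: eq_bigr => i _; rewrite mulrN. Qed.

(** With H x <= e^M x and t the logarithms of the norms of H x, the next iterate
    is at most e^(M - t) x, so its own ratios are at most A (M - t) + t. After
    weighting this is rho M + (1 - rho) t, and t <= M because x has norm 1. *)
Lemma cw_upper_step x : positive x -> normalized x ->
  cw_upper p b H (step H x) <= cw_upper p b H x.
Proof.
move=> x0 x1; have s0 := step_pos x x0.
have [M [HM _ ->]] := cw_upper_witness x x0.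
have [M' [_ HM' ->]] := cw_upper_witness (step H x) s0.
rewrite ler_expR ler_wpM2l//.
have [t [lgt tE]] := lg_step x x0.
have tM i : t i <= M i.
  have := ln_pnorm_le (p_gt0 i) (M i) _ _ (n_gt0 i) (mh_pos _ _ HA x x0 i) (x0 i).
  rewrite x1 ln1 addr0 -tE; apply=> j; have := HM i j; rewrite /lg; lra.
have M'le i : M' i <= \sum_k A i k * (M k - t k) + t i.
  have [j ->] := HM' i.
  have := mh_le _ _ HA (step H x) x (fun k => M k - t k) s0 x0.
  move=> /(_ _ i j); rewrite !lgt => h.
  suff : lg (H (step H x)) i j <= \sum_k A i k * (M k - t k) + lg (H x) i j by lra.
  apply: h => k l; rewrite lgt; have := HM k l; lra.
have := ler_wsum _ _ M'le; have := ler_wsum _ _ tM.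
rewrite wsumD (left_eigen_sum (fun k => M k - t k)) wsumD wsumN.
move: (\sum_i _ * t i) (\sum_i _ * M i) (\sum_i _ * M' i) => X Y Z XY.
have : 0 <= (1 - rho) * (Y - X) by rewrite mulr_ge0 ?subr_ge0.
lra.
Qed.

Lemma cw_lower_step x : positive x -> normalized x ->
  cw_lower p b H x <= cw_lower p b H (step H x).
Proof.
move=> x0 x1; have s0 := step_pos x x0.
have [M [HM _ ->]] := cw_lower_witness x x0.
have [M' [_ HM' ->]] := cw_lower_witness (step H x) s0.
rewrite ler_expR ler_wpM2l//.
have [t [lgt tE]] := lg_step x x0.
have tM i : M i <= t i.
  have := ln_pnorm_le (p_gt0 i) (- M i) _ _ (n_gt0 i) (x0 i) (mh_pos _ _ HA x x0 i).
  rewrite x1 ln1 -tE => h; suff : 0 <= - M i + t i by lra.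
  by apply: h => j; have := HM i j; rewrite /lg; lra.
have M'le i : \sum_k A i k * (M k - t k) + t i <= M' i.
  have [j ->] := HM' i.
  have := mh_le _ _ HA x (step H x) (fun k => - (M k - t k)) x0 s0.
  move=> /(_ _ i j); rewrite !lgt.
  under eq_bigr do rewrite mulrN.
  rewrite sumrN => h.
  suff : lg (H x) i j <= - (\sum_k A i k * (M k - t k)) + lg (H (step H x)) i j by lra.
  apply: h => k l; rewrite lgt; have := HM k l; lra.
have := ler_wsum _ _ M'le; have := ler_wsum _ _ tM.
rewrite wsumD (left_eigen_sum (fun k => M k - t k)) wsumD wsumN.
move: (\sum_i _ * t i) (\sum_i _ * M i) (\sum_i _ * M' i) => X Y Z XY.
have : 0 <= (1 - rho) * (X - Y) by rewrite mulr_ge0 ?subr_ge0.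
lra.
Qed.

Section Eigenvector.
Context (u : bvec R n) (theta : 'I_d -> R).
Hypotheses (u_pos : positive u) (u_norm : normalized u).
Hypotheses (theta_gt0 : forall i, 0 < theta i)
  (Hu : forall i, H u i = theta i *: u i).

Lemma lg_eigen i j : lg (H u) i j = ln (theta i) + lg u i j.
Proof. by rewrite /lg Hu mxE lnM ?posrE. Qed.

(** At the coordinate where x/u is smallest, equal to e^(-a), the ratio of H x
    to x is at least theta e^(a - A a). The weighted sum of a - A a is
    (1 - rho) times that of a, and a >= 0 by normalization. *)
Lemma cw_upper_eigen x : positive x -> normalized x ->
  expR ((gamma p b - 1) * \sum_i b i ord0 * ln (theta i)) <= cw_upper p b H x.
Proof.
move=> x0 x1; have [M [HM _ ->]] := cw_upper_witness x x0.
rewrite ler_expR ler_wpM2l//.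
have [_ [jm [_ mP _]]] := osc_witness x u x0 u_pos.
pose a i := - lratio x u i (jm i).
have ua k l : lg u k l <= a k + lg x k l.
  by have := mP k l; rewrite /a /lratio; lra.
have a0 i : 0 <= a i by apply: (normalized_ge0 u x i) => // l; exact: ua.
have le i : ln (theta i) <= \sum_k A i k * a k + (M i + - a i).
  have := mh_le _ _ HA u x a u_pos x0 ua i (jm i); rewrite lg_eigen.
  by have := HM i (jm i); rewrite /a /lratio; lra.
have := ler_wsum _ _ le; rewrite !wsumD left_eigen_sum wsumN.
have : 0 <= \sum_k b k ord0 * a k.
  by apply: sumr_ge0 => k _; rewrite mulr_ge0// ltW.
move: (\sum_k _ * a k) => X X0.
have : 0 <= (1 - rho) * X by rewrite mulr_ge0 ?subr_ge0.
lra.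
Qed.

Lemma cw_lower_eigen x : positive x -> normalized x ->
  cw_lower p b H x <= expR ((gamma p b - 1) * \sum_i b i ord0 * ln (theta i)).
Proof.
move=> x0 x1; have [M [HM _ ->]] := cw_lower_witness x x0.
rewrite ler_expR ler_wpM2l//.
have [jM [_ [MP _ _]]] := osc_witness x u x0 u_pos.
pose a i := lratio x u i (jM i).
have xa k l : lg x k l <= a k + lg u k l.
  by have := MP k l; rewrite /a /lratio; lra.
have a0 i : 0 <= a i by apply: (normalized_ge0 x u i) => // l; exact: xa.
have le i : M i <= \sum_k A i k * a k + (ln (theta i) + - a i).
  have := mh_le _ _ HA x u a x0 u_pos xa i (jM i); rewrite lg_eigen.
  by have := HM i (jM i); rewrite /a /lratio; lra.
have := ler_wsum _ _ le; rewrite !wsumD left_eigen_sum wsumN.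
have : 0 <= \sum_k b k ord0 * a k.
  by apply: sumr_ge0 => k _; rewrite mulr_ge0// ltW.
move: (\sum_k _ * a k) => X X0.
have : 0 <= (1 - rho) * X by rewrite mulr_ge0 ?subr_ge0.
lra.
Qed.

(** * Convergence to the eigenvector *)

Let step_u : step H u = u. Proof. exact: (step_fix u theta). Qed.

Lemma lratio_le_osc x i j : positive x -> normalized x ->
  `|lratio x u i j| <= osc x u i.
Proof.
move=> x0 x1; have [jM [jm [MP mP ->]]] := osc_witness x u x0 u_pos.
have a0 : 0 <= lratio x u i (jM i).
  by apply: (normalized_ge0 x u i) => // l; have := MP i l; rewrite /lratio; lra.
have c0 : 0 <= - lratio x u i (jm i).
  by apply: (normalized_ge0 u x i) => // l; have := mP i l; rewrite /lratio; lra.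
by rewrite ler_norml; have := MP i j; have := mP i j; lra.
Qed.

(** Proportional vectors are at Hilbert distance zero; normalization rules
    them out, since [lratio x u] then changes sign in every block and is bounded
    by its oscillation. *)
Lemma hilbert_cvg (x : nat -> bvec R n) :
    (forall k, positive (x k)) -> (forall k, normalized (x k.+1)) ->
    (fun k => hilbert_metric b (x k) u) @ \oo --> (0 : R) ->
  x @ \oo --> u.
Proof.
move=> x0 x1 mu0; apply: bvec_cvg => i j.
rewrite -(cvg_shiftS (fun k => x k i ord0 j)).
have -> : [sequence x k.+1 i ord0 j]_k = expR \o (fun k => lg (x k.+1) i j).
  by apply/funext => k; rewrite /= /lg lnK// posrE; exact: x0.
rewrite -[u i ord0 j]lnK ?posrE//.
apply: continuous_cvg; first exact: continuous_expR.
apply/cvgrPdist_lt => e e0.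
have /cvgrPdist_lt/(_ (e * b i ord0)) : 
    (fun k => hilbert_metric b (x k.+1) u) @ \oo --> (0 : R).
  by rewrite (cvg_shiftS (fun k => hilbert_metric b (x k) u)).
move=> /(_ (mulr_gt0 e0 (b_gt0 i))).
apply: filterS => k; rewrite sub0r normrN ger0_norm ?hilbert_ge0//.
rewrite -ltr_pdivrMr// distrC; apply: le_lt_trans.
apply: le_trans (osc_le_hilbert _ _ i (x0 _) u_pos).
rewrite -/(lg u i j) -/(lratio (x k.+1) u i j).
exact: (lratio_le_osc _ _ _ (x0 k.+1) (x1 k)).
Qed.

Lemma iter_step_pos k x : positive x -> positive (iter k (step H) x).
Proof. by move=> x0; elim: k => //= k; exact: step_pos. Qed.

Lemma iter_step_nonexpansive k x y : positive x -> positive y ->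
  hilbert_metric b (iter k (step H) x) (iter k (step H) y) <= hilbert_metric b x y.
Proof.
move=> x0 y0; elim: k => //= k; apply: le_trans.
have xk := iter_step_pos k x x0; have yk := iter_step_pos k y y0.
apply: (le_trans (step_contract _ _ xk yk)).
by rewrite ler_piMl// hilbert_ge0.
Qed.

Lemma cw_sandwich x k (L := expR ((gamma p b - 1) * \sum_i b i ord0 * ln (theta i)))
    (X := fun k => iter k (step H) x) : positive x -> (1 <= k)%N ->
  [/\ cw_lower p b H (X k) <= cw_lower p b H (X k.+1),
      cw_lower p b H (X k) <= L, L <= cw_upper p b H (X k)
    & cw_upper p b H (X k.+1) <= cw_upper p b H (X k)].
Proof.
case: k => [//|k] x0 _; have xk := iter_step_pos k x x0.
have X0 : positive (X k.+1) by exact: step_pos.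
have X1 : normalized (X k.+1) by exact: step_normalized.
split; [exact: cw_lower_step|exact: cw_lower_eigen|exact: cw_upper_eigen|].
exact: cw_upper_step.
Qed.

Section Contraction.
Hypotheses (rho_ge0 : 0 <= rho) (rho_lt1 : rho < 1).

(** The distance D from x to the fixed point satisfies
    D <= dist (step H x) x + rho D. *)
Lemma hilbert_iter x k : positive x ->
  hilbert_metric b (iter k (step H) x) u <=
    hilbert_metric b (step H x) x / (1 - rho) * rho ^+ k.
Proof.
move=> x0; have s0 := step_pos x x0.
have step_le z : positive z ->
    hilbert_metric b (step H z) u <= rho * hilbert_metric b z u.
  by move=> z0; have := step_contract z u z0 u_pos; rewrite step_u.
elim: k => [|k IHk].
  rewrite expr0 mulr1 /= ler_pdivlMr ?subr_gt0//.
  have := hilbert_triangle x (step H x) u x0 s0 u_pos.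
  have := step_le x x0; rewrite (hilbert_sym x (step H x))//.
  move: (hilbert_metric b x u) (hilbert_metric b (step H x) u).
  move: (hilbert_metric b (step H x) x) => h1 h2 h3; lra.
apply: (le_trans (step_le _ (iter_step_pos k x x0))).
by rewrite exprS mulrCA ler_wpM2l.
Qed.

Lemma contracting_iter_cvg x : positive x -> (fun k => iter k (step H) x) @ \oo --> u.
Proof.
move=> x0; apply: hilbert_cvg => [k|k|]; first exact: iter_step_pos.
  by apply: step_normalized; exact: iter_step_pos.
have ub k := hilbert_iter x k x0.
apply: (squeeze_cvgr _ (cvg_cst 0)); last first.
  apply: (@cvg_geometric R (hilbert_metric b (step H x) x / (1 - rho)) rho).
  by rewrite ger0_norm.
apply: nearW => k; rewrite ub andbT hilbert_ge0//; exact: iter_step_pos.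
Qed.

End Contraction.

Section Irreducible.
Context (E : rel J).
Hypothesis E_refl : reflexive E.
Hypothesis E_irr : forall S : {set J}, S != finset.set0 -> S != [set: J]%SET ->
  exists a c, [/\ a \in S, c \notin S & E a c].
Hypothesis H_strict : strict_along E A H.

Definition argmax_set z : {set J} :=
  [set c | [forall l, lratio z u (tag c) l <= lratio z u (tag c) (tagged c)]]%SET.

(** Equality of the distances forces equality in the contraction estimate, block
    by block. A coordinate where the ratio of step H z to u is maximal therefore
    attains the upper bound e^(A a), and strictness excludes an edge from it to
    a coordinate where the ratio of z to u is not maximal. *)
Lemma argmax_step z s c : positive z ->
    hilbert_metric b z u <= hilbert_metric b (step H z) u ->
  s \in argmax_set (step H z) -> E s c -> c \in argmax_set z.
Proof.
move=> z0 Vz; rewrite !inE => /forallP /= s_max Esc.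
apply/forallP => /= l; apply: contrapT => /negP; rewrite -ltNge => l_lt.
have g0 := step_pos z z0.
have [jM [jm [MP mP oE]]] := osc_witness z u z0 u_pos.
have [jM' [jm' [MP' mP' oE']]] := osc_witness (step H z) u g0 u_pos.
pose a k := lratio z u k (jM k); pose e k := lratio z u k (jm k).
have za k l' : lg z k l' <= a k + lg u k l'.
  by move: (MP k l'); rewrite -/(a k) /lratio; lra.
have ze k l' : lg u k l' <= - e k + lg z k l'.
  by move: (mP k l'); rewrite -/(e k) /lratio; lra.
have AoE i : \sum_k A i k * osc z u k = \sum_k A i k * a k - \sum_k A i k * e k.
  by rewrite -sumrB; apply: eq_bigr => k _; rewrite oE mulrBr.
have up i j := mh_le _ _ HA _ _ _ z0 u_pos za i j.
have lo i j : lg (H u) i j <= - \sum_k A i k * e k + lg (H z) i j.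
  have -> : - \sum_k A i k * e k = \sum_k A i k * - e k.
    by rewrite -sumrN; apply: eq_bigr => k _; rewrite mulrN.
  exact: (mh_le _ _ HA).
have [t [tE _]] := lg_step z z0; have [r [rE _]] := lg_step u u_pos.
have lrE i j : lratio (step H z) u i j = lg (H z) i j - t i - (lg (H u) i j - r i).
  by rewrite /lratio tE -rE step_u.
have osc_shrink i : osc (step H z) u i <= \sum_k A i k * osc z u k.
  rewrite oE' AoE !lrE; move: (up i (jM' i)) (lo i (jm' i)).
  set X := \sum_k A i k * a k; set Y := \sum_k A i k * e k.
  by move: X Y => X Y; lra.
have strict : osc (step H z) u (tag s) < \sum_k A (tag s) k * osc z u k.
  have := H_strict z u a z0 u_pos za s c Esc.
  have lt_a : lg z (tag c) (tagged c) < a (tag c) + lg u (tag c) (tagged c).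
    by move: (MP (tag c) l) l_lt; rewrite -/(a (tag c)) /lratio; lra.
  move=> /(_ lt_a); move: (lo (tag s) (jm' (tag s))) (s_max (jM' (tag s))).
  rewrite oE' AoE !lrE.
  set X := \sum_k A _ k * a k; set Y := \sum_k A _ k * e k.
  by move: X Y => X Y; lra.
suff : hilbert_metric b (step H z) u < hilbert_metric b z u by rewrite ltNge Vz.
apply: (@lt_le_trans _ _ (rho * hilbert_metric b z u)); last first.
  by rewrite ler_piMl// hilbert_ge0.
rewrite !hilbertE -(left_eigen_sum (osc z u)).
rewrite (bigD1 (tag s))//= [ltRHS](bigD1 (tag s))//=.
rewrite ltr_leD ?ltr_pM2l//; apply: ler_sum => i _.
by rewrite ler_wpM2l ?(ltW (b_gt0 _)).
Qed.

Lemma argmax_setT z : positive z -> argmax_set z = [set: J]%SET ->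
  hilbert_metric b z u = 0.
Proof.
move=> z0 zT; rewrite hilbertE big1// => i _.
apply/eqP; rewrite mulf_eq0 gt_eqF//=.
rewrite eq_le osc_ge0// andbT; apply: osc_le => // j l.
have : Tagged (fun i => 'I_(n i)) l \in argmax_set z by rewrite zT inE.
by rewrite inE => /forallP/(_ j); rewrite /= subr_le0.
Qed.

(** A bound on the distance to u bounds the logarithms of the normalized
    vectors, so that a cluster point of the logarithms yields a positive one. *)
Lemma hilbert_cluster (y : nat -> bvec R n) (C : R) :
    (forall k, positive (y k)) -> (forall k, normalized (y k.+1)) ->
    (forall k, hilbert_metric b (y k) u <= C) ->
  exists2 z, positive z & forall (e : R) (K : nat), 0 < e ->
    exists2 k, (K <= k)%N & hilbert_metric b (y k) z < e.
Proof.
move=> y0 y1 yC.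
pose w k (c : J) := lg (y k.+1) (tag c) (tagged c).
pose D (c : J) := `|lg u (tag c) (tagged c)| + C / b (tag c) ord0.
have C0 : 0 <= C by apply: le_trans (yC 0); exact: hilbert_ge0.
have D0 c : 0 <= D c by rewrite addr_ge0// divr_ge0// ltW.
have wD k c : `|w k c| <= \sum_c D c.
  apply: (@le_trans _ _ (D c)); last first.
    by rewrite [leRHS](bigD1 c)//= lerDl sumr_ge0.
  have -> : w k c = lg u (tag c) (tagged c) + lratio (y k.+1) u (tag c) (tagged c).
    by rewrite /w /lratio; ring.
  apply: (le_trans (ler_normD _ _)); rewrite lerD2l.
  apply: (le_trans (lratio_le_osc _ _ _ (y0 _) (y1 _))).
  apply: (le_trans (osc_le_hilbert _ _ _ (y0 _) u_pos)).
  by rewrite ler_pM2r ?invr_gt0.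
have [zeta zetaP] := @bounded_cluster R _ w _ wD.
pose z : bvec R n := fun i => \row_j expR (zeta (Tagged (fun i => 'I_(n i)) j)).
have z0 : positive z by move=> i j; rewrite mxE expR_gt0.
have lgz i j : lg z i j = zeta (Tagged (fun i => 'I_(n i)) j) by rewrite /lg mxE expRK.
exists z => // e K e0.
pose B := \sum_i b i ord0.
have B0 : 0 <= B by apply: sumr_ge0 => i _; exact: ltW.
have e'0 : 0 < e / (B + 1) / 2 by rewrite !divr_gt0// ltr_wpDl.
have [k Kk kP] := zetaP _ K e'0.
exists k.+1; first exact: leqW.
apply: (@le_lt_trans _ _ (B * (e / (B + 1)))); last first.
  by rewrite mulrCA gtr_pMr// ltr_pdivrMr ?mul1r ?ltrDl// ltr_wpDl.
rewrite hilbertE mulr_suml; apply: ler_sum => i _.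
rewrite ler_wpM2l ?(ltW (b_gt0 _))//; apply: osc_le => // j l.
have := kP (Tagged (fun i => 'I_(n i)) j); have := kP (Tagged (fun i => 'I_(n i)) l).
rewrite /w /= -!lgz -!/(lratio _ _ _ _) !ltr_norml.
move: (e / (B + 1)) => e1; lra.
Qed.

(** All points of the orbit of a cluster point z are at the limiting distance c
    from u. Among them, one with the fewest maximal coordinates has the same
    maximal set as its successor; that set is closed under the edges of E, so
    it is everything and c = 0. *)
Lemma irreducible_cvg (i0 : 'I_d) (y : bvec R n) : positive y ->
  (fun k => iter k (step H) y) @ \oo --> u.
Proof.
move=> y0; pose Y k := iter k (step H) y; pose v k := hilbert_metric b (Y k) u.
have Y0 k : positive (Y k) by exact: iter_step_pos.
have Y1 k : normalized (Y k.+1) by exact: step_normalized.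
have step_le z : positive z ->
    hilbert_metric b (step H z) u <= hilbert_metric b z u.
  move=> z0; rewrite -[X in hilbert_metric _ _ X]step_u.
  exact: (iter_step_nonexpansive 1).
have v_le : {homo v : k l / (k <= l)%N >-> l <= k}.
  apply: homo_leq => // [a c e ac ce|k]; first exact: le_trans ce ac.
  exact: step_le.
have v_lb : has_lbound (range v).
  by exists 0 => _ [k _ <-]; exact: hilbert_ge0.
have v_cvg := nonincreasing_cvgn v_le v_lb.
set c := inf (range v) in v_cvg.
have [z z0 zP] := hilbert_cluster Y (v 0%N) Y0 Y1 (fun k => v_le _ _ (leq0n k)).
have iter_z0 k := iter_step_pos k z z0.
have Vz k : hilbert_metric b (iter k (step H) z) u = c.
  apply/eqP; rewrite -subr_eq0 -normr_le0; apply/ler_addgt0Pr => e e0.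
  rewrite add0r.
  have e2 : 0 < e / 2 by rewrite divr_gt0.
  have /cvgrPdist_lt/(_ _ e2)[K _ KP] := v_cvg.
  have [l Kl lP] := zP _ K e2.
  have := KP (k + l)%N (leq_trans Kl (leq_addl _ _)).
  have YE : Y (k + l)%N = iter k (step H) (Y l) by rewrite /Y iterD.
  have := iter_step_nonexpansive k _ _ (Y0 l) z0.
  have := hilbert_triangle _ _ _ (iter_z0 k) (Y0 (k + l)%N) u_pos.
  have := hilbert_triangle _ _ _ (Y0 (k + l)%N) (iter_z0 k) u_pos.
  rewrite (hilbert_sym _ _ (iter_z0 k) (Y0 (k + l)%N)) -YE -!/(v _).
  rewrite ltr_norml ler_norml => h1 h2 h3 /andP[h4 h5].
  by apply/andP; split; lra.
pose S k := argmax_set (iter k (step H) z).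
have S_ne k : S k != finset.set0.
  have [jM [_ [MP _ _]]] := osc_witness _ u (iter_z0 k) u_pos.
  apply/finset.set0Pn; exists (Tagged (fun i => 'I_(n i)) (jM i0)).
  by rewrite inE; apply/forallP => l; exact: MP.
have S_step k s e : s \in S k.+1 -> E s e -> e \in S k.
  apply: argmax_step (iter_z0 k) _.
  by have -> := Vz k; have /= -> := Vz k.+1.
have S_sub k : S k.+1 \subset S k.
  by apply/fintype.subsetP => s sS; exact: S_step sS (E_refl s).
pose is_card q := `[< exists k, #|S k| = q >].
have ex_card : exists q, is_card q by exists #|S 0|; apply/asboolP; exists 0%N.
case: (ex_minnP ex_card) => q /asboolP[k Sk] q_min.
have SE : S k.+1 = S k.
  apply/eqP; rewrite eqEcard S_sub Sk q_min//.
  by apply/asboolP; exists k.+1.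
have ST : S k = [set: J]%SET.
  apply/eqP; apply: contrapT => /negP ST.
  have [s [e [sS eS Ese]]] := E_irr _ (S_ne k) ST.
  by case/negP: eS; apply: S_step Ese; rewrite SE.
apply: hilbert_cvg => //.
by rewrite -(argmax_setT _ (iter_z0 k) ST) Vz.
Qed.

End Irreducible.
End Eigenvector.
End MultihomogeneousMaps.

(** * The gradient of the form of a tensor *)

Section Gradient.
Context {R : realType} {m : nat} {N : 'I_m -> nat} (T : tensor R N).
Local Notation idx := {dffun forall j : 'I_m, 'I_(N j)}.

Lemma dfwith_shiftE {d : nat} {n : 'I_d -> nat} (x : bvec R n)
    (i : 'I_d) (j : 'I_(n i)) (t : R) (k : 'I_d) (l : 'I_(n k)) :
  (dfwith x i (x i + t *: delta_mx ord0 j) : bvec R n) k ord0 l =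
    x k ord0 l + t * (Tagged (fun i => 'I_(n i)) l == Tagged (fun i => 'I_(n i)) j)%:R.
Proof.
case: dfwithP => [|k' ik] in l *; first by rewrite !mxE eqxx eq_Tagged.
suff /negPf-> : Tagged (fun i => 'I_(n i)) l != Tagged (fun i => 'I_(n i)) j
  by rewrite mulr0 addr0.
by apply: contra_neq ik => /(congr1 tag).
Qed.

Lemma derive1_affine (a g : R) : derive1 (fun t : R => a + t * g) 0 = g.
Proof.
rewrite derive1E; apply: derive_val.
have -> : (fun t : R => a + t * g) = (cst a : R -> R) + (g \*: (id : R -> R)).
  by apply/funext => t; rewrite /= mulrC.
by apply: is_derive_eq; rewrite add0r scaler1.
Qed.

(** Every monomial contains exactly one coordinate of z_s, to the first power, so
    the form is affine along each coordinate direction of z_s. *)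
Lemma tgradE (z : bvec R N) s j : tgrad T s z ord0 j =
  \sum_(J : idx | J s == j) T J * \prod_(k < m | k != s) z k ord0 (J k).
Proof.
rewrite mxE /partial -[RHS](derive1_affine (tform T z)); congr derive1.
apply/funext => t; rewrite /tform mulr_sumr [X in _ = _ + X]big_mkcond -big_split /=.
apply: eq_bigr => J _.
rewrite (bigD1 s)//= dfwith_shiftE eq_Tagged [in RHS](bigD1 s)//=.
rewrite (eq_bigr (fun k => z k ord0 (J k))) => [|k ks]; last first.
  rewrite dfwithout// eq_sym//.
by case: eqP => _; rewrite /= ?mulr1 ?mulr0 ?addr0 //; ring.
Qed.

Context {d : nat} (sigma : shape_partition N d).
Implicit Types x y : bvec R (sdim sigma).

(** The coordinate of x, inside the vector repeated along the block of k, that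
    position k of the multi-index J reads. *)
Definition coord (J : idx) (k : 'I_m) :
    'I_(sdim sigma (block_of sigma k)) :=
  cast_ord (esym (sdim_block_of sigma k)) (J k).

Lemma spreadE x (J : idx) k :
  spread x k ord0 (J k) = x (block_of sigma k) ord0 (coord J k).
Proof. by rewrite /spread castmxE cast_ord_id. Qed.

Definition bgrad i j x : R := tgrad T (smin sigma i) (spread x) ord0 j.

Lemma bgradE i (j : 'I_(sdim sigma i)) x : bgrad i j x =
  \sum_(J : idx | J (smin sigma i) == j)
    T J * \prod_(k < m | k != smin sigma i) x (block_of sigma k) ord0 (coord J k).
Proof.
rewrite /bgrad tgradE; apply: eq_bigr => J _; congr (_ * _).
by apply: eq_bigr => k _; exact: spreadE.
Qed.

Lemma block_of_eq k l : k \in block sigma l -> block_of sigma k = l.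
Proof.
move=> kl; have kb : k \in block sigma (block_of sigma k) by exact: (xchooseP (block_cover sigma k)).
have /and3P[_ /finset.trivIsetP tI _] := block_partition sigma.
apply: (@block_inj _ _ _ sigma); apply/eqP; apply: contraT => ne.
have mem i : block sigma i \in [set block sigma i | i : 'I_d]%SET.
  by apply/imsetP; exists i.
have := tI _ _ (mem _) (mem _) ne; rewrite disjoint_subset.
by move=> /fintype.subsetP/(_ k kb); rewrite inE kl.
Qed.

Lemma block_of_smin i : block_of sigma (smin sigma i) = i.
Proof.
apply: block_of_eq; rewrite /smin; case: arg_minnP => //.
exact: (xchooseP (block_nonempty _ _)).
Qed.

(** The degree of T_(s_i) in block l is nu_l, less one when l = i because the
    position s_i has been differentiated away. *)
Lemma sum_block_of (a : 'I_d -> R) i :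
  \sum_(k < m | k != smin sigma i) a (block_of sigma k) =
  \sum_l ((nu sigma l)%:R - (i == l)%:R) * a l.
Proof.
have -> : \sum_(k < m | k != smin sigma i) a (block_of sigma k) =
    \sum_(k < m) a (block_of sigma k) - a i.
  by rewrite [in RHS](bigD1 (smin sigma i))//= block_of_smin addrC addrK.
under [RHS]eq_bigr do rewrite mulrBl.
rewrite sumrB; congr (_ - _); last first.
  rewrite (bigD1 i)//= eqxx mul1r big1 ?addr0// => k /negPf ki.
  by rewrite eq_sym ki mul0r.
rewrite (partition_big (block_of sigma) xpredT)//=; apply: eq_bigr => l _.
rewrite (eq_bigr (fun=> a l)) => [|k /eqP-> //].
rewrite sumr_const mulr_natl; congr (_ *+ _); apply: eq_card => k.
suff : (block_of sigma k == l) = (k \in block sigma l) by [].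
apply/eqP/idP => [<-|]; last exact: block_of_eq.
exact: (xchooseP (block_cover sigma k)).
Qed.

Hypothesis T_ge0 : forall J, 0 <= T J.

(** The left-hand side has absolute values so that the bound also applies to
    eigenvectors with entries of any sign. *)
Lemma bgrad_le x y (a : 'I_d -> R) :
    (forall k l, `|x k ord0 l| <= expR (a k) * y k ord0 l) ->
  forall i j, `|bgrad i j x| <=
    expR (\sum_l ((nu sigma l)%:R - (i == l)%:R) * a l) * bgrad i j y.
Proof.
move=> xy i j; rewrite !bgradE mulr_sumr.
apply: (le_trans (ler_norm_sum _ _ _)); apply: ler_sum => J _.
rewrite normrM ger0_norm// mulrCA ler_wpM2l// normr_prod -sum_block_of expR_sum.
by rewrite -big_split /=; apply: ler_prod => k _; rewrite normr_ge0 xy.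
Qed.

(** If no monomial with nonzero coefficient in row a read the coordinate c, the
    function differentiated in M would be constant in that coordinate. *)
Lemma Mmat_support (a c : Isigma sigma) : Mmat T a c != 0 ->
  exists J k, [/\ 0 < T J, J (smin sigma (tag a)) = tagged a,
    k != smin sigma (tag a)
    & Tagged (fun i => 'I_(sdim sigma i)) (coord J k) = c].
Proof.
move=> M0; apply: contrapT => noJ; case/eqP: M0; rewrite /Mmat /partial.
rewrite (_ : (fun t : R => _) = cst (bgrad (tag a) (tagged a) (fun i => const_mx 1))).
  by rewrite derive1_cst.
apply/funext => t; rewrite /= -/(bgrad _ _ _) !bgradE; apply: eq_bigr => J /eqP Ja.
have [T0|T0] := eqVneq (T J) 0; first by rewrite T0 !mul0r.
congr (_ * _); apply: eq_bigr => k ks; rewrite dfwith_shiftE.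
case: eqP => [kc|]; last by rewrite mulr0 addr0.
case: noJ; exists J, k; split=> //; first by rewrite lt_neqAle eq_sym T0 T_ge0.
by rewrite kc; case: (c).
Qed.

Lemma bgrad_lt x y (a : 'I_d -> R) :
    positive x -> positive y ->
    (forall k l, x k ord0 l <= expR (a k) * y k ord0 l) ->
  forall s c : Isigma sigma, Mmat T s c != 0 ->
    x (tag c) ord0 (tagged c) < expR (a (tag c)) * y (tag c) ord0 (tagged c) ->
  bgrad (tag s) (tagged s) x <
    expR (\sum_l ((nu sigma l)%:R - (tag s == l)%:R) * a l) *
    bgrad (tag s) (tagged s) y.
Proof.
move=> x0 y0 xy s c /Mmat_support[J [k [TJ Js ks cE]]] xyc.
rewrite !bgradE mulr_sumr -sum_block_of expR_sum.
rewrite (bigD1 J) ?Js//= [ltRHS](bigD1 J) ?Js//=.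
apply: ltr_leD; last first.
  apply: ler_sum => J' _; rewrite mulrCA ler_wpM2l// -big_split /=.
  by apply: ler_prod => l _; rewrite ltW//=.
rewrite mulrCA ltr_pM2l// -big_split /= (bigD1 k)//= [ltRHS](bigD1 k)//=.
apply: (@lt_le_trans _ _ (expR (a (block_of sigma k)) *
  y (block_of sigma k) ord0 (coord J k) *
  \prod_(i < m | (i != smin sigma (tag s)) && (i != k))
    x (block_of sigma i) ord0 (coord J i))).
  rewrite ltr_pM2r ?prodr_gt0//; first by move: xyc; rewrite -cE.
rewrite ler_pM2l ?mulr_gt0 ?expR_gt0//.
by apply: ler_prod => l _; rewrite ltW//=.
Qed.

Hypothesis T_strict : strictly_nonnegative sigma T.

Lemma bgrad_gt0 x i j : positive x -> 0 < bgrad i j x.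
Proof.
move=> x0.
have [c /Mmat_support[J [k [TJ Js _ _]]]] := T_strict (Tagged _ j).
rewrite bgradE (bigD1 J) ?Js//= ltr_pwDl ?mulr_gt0 ?prodr_gt0//.
apply: sumr_ge0 => J' _; rewrite mulr_ge0// prodr_ge0// => l _; exact: ltW.
Qed.

End Gradient.

Arguments bgrad {R m N} T {d sigma} i j x.

(** * Powers and geometric means of multi-homogeneous maps *)

Section Constructions.
Context {R : realType} {d : nat} {n : 'I_d -> nat}.
Implicit Types x y : bvec R n.
Local Notation J := {i : 'I_d & 'I_(n i)}.

Lemma ln_scale_le (c s X Y : R) : 0 < c -> 0 < X -> 0 < Y ->
  X <= expR s * Y -> c * ln X <= c * s + c * ln Y.
Proof.
move=> c0 X0 Y0 XY; rewrite -mulrDr ler_pM2l//.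
by rewrite -[s]expRK -lnM ?posrE ?expR_gt0// ler_ln ?posrE ?mulr_gt0 ?expR_gt0.
Qed.

Lemma ln_scale_lt (c s X Y : R) : 0 < c -> 0 < X -> 0 < Y ->
  X < expR s * Y -> c * ln X < c * s + c * ln Y.
Proof.
move=> c0 X0 Y0 XY; rewrite -mulrDr ltr_pM2l//.
by rewrite -[s]expRK -lnM ?posrE ?expR_gt0// ltr_ln ?posrE ?mulr_gt0 ?expR_gt0.
Qed.

Lemma le_lg x y i j (a : R) : positive x -> positive y ->
  (lg x i j <= a + lg y i j) = (x i ord0 j <= expR a * y i ord0 j).
Proof.
move=> x0 y0; rewrite -[in LHS](expRK a) -lnM ?posrE ?expR_gt0//.
by rewrite ler_ln ?posrE ?mulr_gt0 ?expR_gt0.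
Qed.

Lemma lt_lg x y i j (a : R) : positive x -> positive y ->
  (lg x i j < a + lg y i j) = (x i ord0 j < expR a * y i ord0 j).
Proof.
move=> x0 y0; rewrite -[in LHS](expRK a) -lnM ?posrE ?expR_gt0//.
by rewrite ltr_ln ?posrE ?mulr_gt0 ?expR_gt0.
Qed.

(** Raising the blocks to the powers q multiplies the rows of the degree matrix
    D by q. *)
Section Power.
Context (P : forall i, 'I_(n i) -> bvec R n -> R) (D A : 'M[R]_d) (q : 'I_d -> R).
Hypothesis q_gt0 : forall i, 0 < q i.
Hypothesis AE : forall i k, A i k = q i * D i k.
Hypothesis P_gt0 : forall x i j, positive x -> 0 < P i j x.

Definition power_map x : bvec R n := fun i => \row_j (P i j x `^ q i).

Lemma lg_power x i j : lg (power_map x) i j = q i * ln (P i j x).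
Proof. by rewrite /lg mxE ln_powR. Qed.

Lemma power_sum i (a : 'I_d -> R) :
  \sum_k A i k * a k = q i * \sum_k D i k * a k.
Proof. by rewrite mulr_sumr; apply: eq_bigr => k _; rewrite AE mulrA. Qed.

Lemma power_multihomogeneous :
    (forall x y (a : 'I_d -> R), positive x -> positive y ->
      (forall k l, x k ord0 l <= expR (a k) * y k ord0 l) ->
      forall i j, P i j x <= expR (\sum_k D i k * a k) * P i j y) ->
  multihomogeneous A power_map.
Proof.
move=> P_le; split=> [x x0 i j|x y a x0 y0 xy i j].
  by rewrite mxE powR_gt0// P_gt0.
rewrite !lg_power power_sum; apply: ln_scale_le; rewrite ?q_gt0 ?P_gt0//.
by apply: P_le => // k l; rewrite -le_lg.
Qed.

Lemma power_strict (E : rel J) :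
    (forall x y (a : 'I_d -> R), positive x -> positive y ->
      (forall k l, x k ord0 l <= expR (a k) * y k ord0 l) ->
      forall s c : J, E s c ->
        x (tag c) ord0 (tagged c) < expR (a (tag c)) * y (tag c) ord0 (tagged c) ->
        P (tag s) (tagged s) x <
          expR (\sum_k D (tag s) k * a k) * P (tag s) (tagged s) y) ->
  strict_along E A power_map.
Proof.
move=> P_lt x y a x0 y0 xy s c sc; rewrite lt_lg// => xyc.
rewrite !lg_power power_sum; apply: ln_scale_lt; rewrite ?q_gt0 ?P_gt0//.
by apply: (P_lt _ _ _ x0 y0 _ s c) => // k l; rewrite -le_lg.
Qed.

End Power.

(** In logarithms the geometric mean of x and H x is the average of the two, so
    its matrix is the average of the identity and A, and each of its coordinates
    depends on itself. *)
Section GeometricMean.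
Context (A : 'M[R]_d) (H : bvec R n -> bvec R n).
Hypothesis HA : multihomogeneous A H.

Definition mean_map x : bvec R n :=
  fun i => \row_j Num.sqrt (x i ord0 j * H x i ord0 j).

Definition mean_mx : 'M[R]_d := 2^-1 *: (1%:M + A).

Lemma mean_mx_sum i (a : 'I_d -> R) :
  \sum_k mean_mx i k * a k = 2^-1 * (a i + \sum_k A i k * a k).
Proof.
have -> : a i = \sum_k (1%:M : 'M[R]_d) i k * a k.
  rewrite (bigD1 i)//= mxE eqxx mul1r big1 ?addr0// => k /negPf ki.
  by rewrite mxE eq_sym ki mul0r.
rewrite -big_split mulr_sumr; apply: eq_bigr => k _ /=.
by rewrite -mulrDl mulrA !mxE.
Qed.

Lemma lg_mean x i j : positive x ->
  lg (mean_map x) i j = 2^-1 * (lg x i j + lg (H x) i j).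
Proof.
move=> x0; have F0 := mh_pos _ _ HA x x0.
have xF : 0 < x i ord0 j * H x i ord0 j by rewrite mulr_gt0.
have s0 : 0 < Num.sqrt (x i ord0 j * H x i ord0 j) by rewrite sqrtr_gt0.
have E : ln (Num.sqrt (x i ord0 j * H x i ord0 j)) *+ 2 = lg x i j + lg (H x) i j.
  by rewrite -lnXn// sqr_sqrtr ?ltW// lnM ?posrE.
rewrite -E mulr2n {1}/lg mxE.
by move: (ln _) => t; field.
Qed.

Lemma mean_multihomogeneous : multihomogeneous mean_mx mean_map.
Proof.
split=> [x x0 i j|x y a x0 y0 xy i j].
  by rewrite mxE sqrtr_gt0 mulr_gt0//; exact: (mh_pos _ _ HA).
rewrite !lg_mean// mean_mx_sum -mulrDr ler_wpM2l ?invr_ge0// addrACA lerD//.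
exact: (mh_le _ _ HA).
Qed.

Lemma mean_strict (E : rel J) : strict_along E A H ->
  strict_along (fun s c => (s == c) || E s c) mean_mx mean_map.
Proof.
move=> H_lt x y a x0 y0 xy s c sc xyc; rewrite !lg_mean// mean_mx_sum -mulrDr.
rewrite ltr_pM2l ?invr_gt0// addrACA.
have [sE|sNc] := eqVneq s c.
  rewrite ltr_leD// ?sE//.
  exact: (mh_le _ _ HA _ _ _ x0 y0 xy).
rewrite (negPf sNc) /= in sc.
by apply: ler_ltD => //; exact: (H_lt _ _ _ x0 y0 xy _ c).
Qed.

Lemma mean_left_eigen (b : 'cV[R]_d) (rho : R) :
    (forall k, \sum_i b i ord0 * A i k = rho * b k ord0) ->
  forall k, \sum_i b i ord0 * mean_mx i k = (2^-1 * (1 + rho)) * b k ord0.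
Proof.
move=> bA k.
have -> : \sum_i b i ord0 * mean_mx i k = 2^-1 * (\sum_i b i ord0 * (i == k)%:R +
    \sum_i b i ord0 * A i k).
  rewrite -big_split mulr_sumr; apply: eq_bigr => i _ /=.
  by rewrite !mxE -mulrDr mulrCA.
rewrite bA (bigD1 k)//= eqxx mulr1 big1 ?addr0 => [|i /negPf->].
  by rewrite -{1}[b k ord0]mul1r -mulrDl mulrA.
by rewrite mulr0.
Qed.

End GeometricMean.
End Constructions.


(** * The maps F and G *)

Section PowerMaps.
Context {R : realType} {m d : nat} {N : 'I_m -> nat}.
Context (sigma : shape_partition N d) (p : 'I_d -> R) (T : tensor R N).
Hypothesis T_ge0 : forall J, 0 <= T J.
Hypothesis p_gt1 : forall i, 1 < p i.
Hypothesis T_strict : strictly_nonnegative sigma T.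
Implicit Types x y : bvec R (sdim sigma).

Lemma conj_expB1 i : conj_exp (p i) - 1 = (p i - 1)^-1.
Proof.
have p1 : p i - 1 != 0 by rewrite subr_eq0 gt_eqF.
by rewrite /conj_exp; field.
Qed.

Lemma conj_expB1_gt0 i : 0 < conj_exp (p i) - 1.
Proof. by rewrite conj_expB1 invr_gt0 subr_gt0. Qed.

Lemma homogeneity_mxE i k : homogeneity_mx sigma p i k =
  (conj_exp (p i) - 1) * ((nu sigma k)%:R - (i == k)%:R).
Proof.
rewrite /homogeneity_mx mul_diag_mx !mxE big_ord1 !mxE mul1r.
by rewrite eq_sym.
Qed.

Lemma Fmap_multihomogeneous :
  multihomogeneous (homogeneity_mx sigma p) (Fmap (sigma := sigma) p T).
Proof.
apply: (power_multihomogeneous (bgrad T)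
  (\matrix_(i, k) ((nu sigma k)%:R - (i == k)%:R))).
- exact: conj_expB1_gt0.
- by move=> i k; rewrite homogeneity_mxE mxE.
- by move=> x i j; exact: bgrad_gt0.
move=> x y a x0 y0 xy i j.
under eq_bigr do rewrite mxE.
rewrite -[leLHS]gtr0_norm ?bgrad_gt0//; apply: bgrad_le => // k l.
by rewrite (gtr0_norm (x0 k l)).
Qed.

Lemma Fmap_strict : strict_along (fun s c => Mmat T s c != 0)
  (homogeneity_mx sigma p) (Fmap (sigma := sigma) p T).
Proof.
apply: (power_strict (bgrad T) (\matrix_(i, k) ((nu sigma k)%:R - (i == k)%:R))).
- exact: conj_expB1_gt0.
- by move=> i k; rewrite homogeneity_mxE mxE.
- by move=> x i j; exact: bgrad_gt0.
move=> x y a x0 y0 xy s c sc xyc.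
under eq_bigr do rewrite mxE.
exact: (bgrad_lt T sigma T_ge0 x y a x0 y0 xy s c).
Qed.

Section PerronVector.
Context (b : 'cV[R]_d).
Hypothesis bP : left_perron_vector (homogeneity_mx sigma p) b.
Let rho := mx_spectral_radius (homogeneity_mx sigma p).

Lemma perron_gt0 i : 0 < b i ord0.
Proof. by case: bP. Qed.

Lemma perron_left k :
  \sum_i b i ord0 * homogeneity_mx sigma p i k = rho * b k ord0.
Proof.
case: bP => _ E _; transitivity ((rho *: b) k ord0); last by rewrite mxE.
by rewrite -E mxE; apply: eq_bigr => i _; rewrite [X in _ = X * _]mxE mulrC.
Qed.

(** The entries of b sum to 1, so there is at least one block. *)
Lemma perron_index : exists i : 'I_d, True.
Proof.
case: bP => _ _; case: (d) b => [b0|d' b0 _]; last by exists ord0.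
by rewrite big_ord0 => /eqP; rewrite eq_sym oner_eq0.
Qed.

Lemma rho_ge0 : 0 <= rho.
Proof.
have [k _] := perron_index.
have : 0 <= rho * b k ord0.
  rewrite -perron_left; apply: sumr_ge0 => i _.
  rewrite mulr_ge0 ?(ltW (perron_gt0 _))// homogeneity_mxE.
  rewrite mulr_ge0 ?(ltW (conj_expB1_gt0 _))// subr_ge0 ler_nat.
  case: eqP => //= _; rewrite /nu card_gt0; apply/finset.set0Pn.
  exact: block_nonempty.
by rewrite pmulr_lge0// perron_gt0.
Qed.

Let B := \sum_i b i ord0 * (conj_exp (p i) - 1).

Let B_gt0 : 0 < B.
Proof.
have [k _] := perron_index.
rewrite /B (bigD1 k)//= ltr_pwDl ?mulr_gt0 ?perron_gt0 ?conj_expB1_gt0//.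
by apply: sumr_ge0 => i _; rewrite mulr_ge0 ?(ltW (perron_gt0 _)) ?(ltW (conj_expB1_gt0 _)).
Qed.

(** The exponent in the Collatz-Wielandt numbers is chosen to undo the powers
    p_i' - 1 in the eigenvalue of F: this is what makes them equal to lambda at
    an eigenvector ([Ftheta_sum]). *)
Lemma gammaB1 : gamma p b - 1 = B^-1.
Proof.
rewrite /gamma.
have -> : \sum_i b i ord0 * conj_exp (p i) = B + 1.
  case: bP => _ _ <-; rewrite -big_split; apply: eq_bigr => i _ /=.
  by rewrite mulrBr mulr1 subrK.
by rewrite addrK; field; exact: lt0r_neq0.
Qed.

Lemma gammaB1_gt0 : 0 < gamma p b - 1.
Proof. by rewrite gammaB1 invr_gt0. Qed.

End PerronVector.
End PowerMaps.

(** * The spectral radius is the eigenvalue of a positive eigenvector *)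

Lemma pnorm_eq1_dim (R : realType) (n : nat) (q : R) (v : 'rV[R]_n) :
  0 < q -> pnorm q v = 1 -> (0 < n)%N.
Proof.
case: n v => [v q0|//]; have qN0 : q^-1 != 0 by rewrite invr_eq0 gt_eqF.
rewrite /pnorm big_ord0 powR0// => /eqP.
by rewrite eq_sym oner_eq0.
Qed.

Section PositiveEigenpair.
Context {R : realType} {m d : nat} {N : 'I_m -> nat}.
Context (sigma : shape_partition N d) (p : 'I_d -> R) (T : tensor R N).
Hypothesis T_ge0 : forall J, 0 <= T J.
Hypothesis p_gt1 : forall i, 1 < p i.
Hypothesis T_strict : strictly_nonnegative sigma T.
Context (b : 'cV[R]_d).
Hypothesis bP : left_perron_vector (homogeneity_mx sigma p) b.
Context (lambda : R) (u : bvec R (sdim sigma)).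
Hypothesis u_eigen : eigenpair p T lambda u.
Hypothesis u_pos : positive u.

Lemma p_gt0 i : 0 < p i. Proof. exact: lt_trans ltr01 (p_gt1 i). Qed.

Lemma eigen_normalized : normalized p u.
Proof. by move=> i; have [] := u_eigen i. Qed.

Lemma sdim_gt0 i : (0 < sdim sigma i)%N.
Proof. exact: pnorm_eq1_dim (p_gt0 i) (eigen_normalized i). Qed.

Lemma eigenE (c : R) (v : bvec R (sdim sigma)) i j : eigenpair p T c v ->
  bgrad T i j v = c * (`|v i ord0 j| `^ (p i - 1) * Num.sg (v i ord0 j)).
Proof. by move=> /(_ i)[E _]; rewrite /bgrad E !mxE. Qed.

Lemma eigen_posE i j : bgrad T i j u = lambda * u i ord0 j `^ (p i - 1).
Proof. by rewrite (eigenE _ _ _ _ u_eigen) gtr0_sg// gtr0_norm// mulr1. Qed.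

Lemma eigenvalue_gt0 : 0 < lambda.
Proof.
have [i _] := perron_index sigma p b bP.
have := bgrad_gt0 T sigma T_ge0 T_strict u i (Ordinal (sdim_gt0 i)) u_pos.
by rewrite eigen_posE pmulr_lgt0// powR_gt0.
Qed.

Definition Ftheta i := lambda `^ (conj_exp (p i) - 1).

Lemma Ftheta_gt0 i : 0 < Ftheta i.
Proof. by rewrite powR_gt0// eigenvalue_gt0. Qed.

Lemma Fmap_eigen i : Fmap p T u i = Ftheta i *: u i.
Proof.
apply/rowP => j; rewrite [LHS]mxE [RHS]mxE -/(bgrad T i j u) eigen_posE.
rewrite powRM ?powR_ge0 ?(ltW eigenvalue_gt0)// -powRrM conj_expB1//.
have p1 : p i - 1 != 0 by rewrite subr_eq0 gt_eqF.
by rewrite mulfV// powRr1 ?(ltW (u_pos i j))// /Ftheta conj_expB1.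
Qed.

Lemma Gmap_eigen i : Gmap p T u i = Num.sqrt (Ftheta i) *: u i.
Proof.
apply/rowP => j; rewrite [LHS]mxE [RHS]mxE Fmap_eigen [X in _ * X]mxE.
rewrite mulrCA sqrtrM ?(ltW (Ftheta_gt0 _))// -expr2 sqrtr_sqr.
by rewrite gtr0_norm.
Qed.

Lemma Ftheta_sum :
  (gamma p b - 1) * \sum_i b i ord0 * ln (Ftheta i) = ln lambda.
Proof.
under eq_bigr do rewrite ln_powR mulrA.
rewrite -mulr_suml (gammaB1 sigma p p_gt1 b bP) mulKf//.
rewrite -invr_eq0 -(gammaB1 sigma p p_gt1 b bP) gt_eqF//.
exact: (gammaB1_gt0 sigma).
Qed.

Lemma Gtheta_sum :
  expR ((gamma p b - 1) * \sum_i b i ord0 * ln (Num.sqrt (Ftheta i))) ^+ 2 =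
  lambda.
Proof.
rewrite -expRM_natl mulrCA.
have -> : 2%:R * \sum_i b i ord0 * ln (Num.sqrt (Ftheta i)) =
    \sum_i b i ord0 * ln (Ftheta i).
  rewrite mulr_sumr; apply: eq_bigr => i _; rewrite mulrCA; congr (_ * _).
  rewrite mulr_natl -lnXn ?sqrtr_gt0 ?Ftheta_gt0// sqr_sqrtr//.
  exact: ltW (Ftheta_gt0 i).
by rewrite Ftheta_sum lnK// posrE eigenvalue_gt0.
Qed.

Hypothesis rho_le1 : mx_spectral_radius (homogeneity_mx sigma p) <= 1.

(** Let e^a be the largest ratios of |v| to u in the blocks. Comparing the two
    eigenvalue equations at the coordinates where they are attained gives
    (p' - 1) ln |c| + a <= A a + (p' - 1) ln lambda. Weighting by b leaves
    (1 - rho) times the sum of the a, which is nonnegative because u and v have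
    the same norms. *)
Lemma eigenvalue_le c (v : bvec R (sdim sigma)) : eigenpair p T c v -> `|c| <= lambda.
Proof.
move=> cv; have l0 := eigenvalue_gt0.
have [c_eq0|c_neq0] := eqVneq c 0; first by rewrite c_eq0 normr0 ltW.
have c0 : 0 < `|c| by rewrite normr_gt0.
(* v may have zero entries, so the maximum is taken before the logarithm. *)
have [jM jMP] := dependent_argmax sdim_gt0
  (fun i j => `|v i ord0 j| / u i ord0 j).
pose al i := `|v i ord0 (jM i)| / u i ord0 (jM i).
have v_le i j : `|v i ord0 j| <= al i * u i ord0 j.
  by rewrite -ler_pdivrMr//; exact: jMP.
have al0 i : 0 <= al i by rewrite divr_ge0// ltW.
have al1 i : 1 <= al i.
  have [_ v1] := cv i; have [_ u1] := u_eigen i.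
  rewrite -v1 -[leRHS]mulr1 -u1; apply: (pnorm_le (p_gt0 i)) => // j.
  by rewrite [X in _ * X]gtr0_norm.
have alpos i : 0 < al i by exact: lt_le_trans ltr01 (al1 i).
pose a i := ln (al i).
have a0 i : 0 <= a i by exact: ln_ge0.
have v_lea k l : `|v k ord0 l| <= expR (a k) * u k ord0 l.
  by rewrite /a lnK ?posrE.
have key i : (conj_exp (p i) - 1) * ln `|c| + a i <=
    \sum_k homogeneity_mx sigma p i k * a k + (conj_exp (p i) - 1) * ln lambda.
  have := bgrad_le T sigma T_ge0 v u a v_lea i (jM i).
  rewrite (eigenE _ _ _ _ cv) eigen_posE.
  have vM : `|v i ord0 (jM i)| = expR (a i) * u i ord0 (jM i).
    by rewrite /a lnK ?posrE// divfK// gt_eqF.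
  have vM0 : 0 < `|v i ord0 (jM i)| by rewrite vM mulr_gt0 ?expR_gt0.
  rewrite normrM normrM normr_sg -normr_gt0 vM0 mulr1 (ger0_norm (powR_ge0 _ _)).
  set D := \sum_l ((nu sigma l)%:R - (i == l)%:R) * a l.
  have -> : \sum_k homogeneity_mx sigma p i k * a k = (conj_exp (p i) - 1) * D.
    by rewrite mulr_sumr; apply: eq_bigr => k _; rewrite homogeneity_mxE mulrA.
  have e0 : 0 < expR D by exact: expR_gt0.
  have ua0 : 0 < expR (a i) * u i ord0 (jM i) by rewrite mulr_gt0// expR_gt0.
  have up0 : 0 < u i ord0 (jM i) `^ (p i - 1) by rewrite powR_gt0.
  have uap0 : 0 < (expR (a i) * u i ord0 (jM i)) `^ (p i - 1) by rewrite powR_gt0.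
  rewrite vM => h; have : ln (`|c| * (expR (a i) * u i ord0 (jM i)) `^ (p i - 1)) <=
      ln (expR D * (lambda * u i ord0 (jM i) `^ (p i - 1))).
    by rewrite ler_ln ?posrE ?mulr_gt0// mulr_gt0.
  have -> : ln (`|c| * (expR (a i) * u i ord0 (jM i)) `^ (p i - 1)) =
      ln `|c| + (p i - 1) * (a i + ln (u i ord0 (jM i))).
    by rewrite lnM ?posrE// ln_powR lnM ?posrE ?expR_gt0// expRK.
  have -> : ln (expR D * (lambda * u i ord0 (jM i) `^ (p i - 1))) =
      D + (ln lambda + (p i - 1) * ln (u i ord0 (jM i))).
    by rewrite lnM ?posrE ?mulr_gt0// expRK lnM ?posrE// ln_powR.
  rewrite conj_expB1//.
  move: (ln `|c|) (ln lambda) (ln (u i ord0 (jM i))) (a i) D {e0 h} => C L U X D h.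
  have q0 : 0 < p i - 1 by rewrite subr_gt0.
  rewrite -(ler_pM2l q0) !mulrDr !mulrA mulfV ?gt_eqF// !mul1r.
  by move: h; rewrite mulrDr; lra.
have bgt0 := perron_gt0 sigma p b bP.
have := ler_wsum b bgt0 _ _ key; rewrite !wsumD.
rewrite (left_eigen_sum b _ _ (perron_left sigma p b bP)).
under [X in X + _ <= _]eq_bigr do rewrite mulrA.
under [X in _ <= _ + X]eq_bigr do rewrite mulrA.
rewrite -!mulr_suml => key2.
have B0 : 0 < \sum_i b i ord0 * (conj_exp (p i) - 1).
  by rewrite -invr_gt0 -(gammaB1 sigma p p_gt1 b bP); exact: (gammaB1_gt0 sigma).
rewrite -ler_ln ?posrE// -(ler_pM2l B0).
have X0 : 0 <= \sum_k b k ord0 * a k.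
  by apply: sumr_ge0 => k _; rewrite mulr_ge0// ltW.
move: (mx_spectral_radius _) rho_le1 key2 => rho rho1.
move: (\sum_k b k ord0 * a k) X0 => X X0.
have : 0 <= (1 - rho) * X by rewrite mulr_ge0 ?subr_ge0.
move: (_ * ln `|c|) (_ * ln lambda) => U V; lra.
Qed.

Lemma tspectral_radius_eigen : tspectral_radius sigma p T = lambda.
Proof.
have mem : [set `|c| | c in teigenvalue sigma p T] lambda.
  exists lambda; first by exists u.
  by rewrite gtr0_norm// eigenvalue_gt0.
have ub : ubound [set `|c| | c in teigenvalue sigma p T] lambda.
  by move=> _ [c [v cv] <-]; exact: eigenvalue_le cv.
apply/eqP; rewrite eq_le; apply/andP; split.
  by apply: ge_sup => //; exists lambda.
by apply: ub_le_sup => //; exists lambda.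
Qed.

End PositiveEigenpair.

(** * Convergence of the power methods *)

Theorem theorem3p3 (R : realType) (m d : nat) (N : 'I_m -> nat)
    (T : tensor R N) (sigma : shape_partition N d) (p : 'I_d -> R)
    (b : 'cV[R]_d) (u x0 y0 : bvec R (sdim sigma))
    (T_ge0 : forall J, 0 <= T J)
    (p_gt1 : forall i, 1 < p i)
    (bP : left_perron_vector (homogeneity_mx sigma p) b)
    (T_strict : strictly_nonnegative sigma T)
    (u_eigen : teigenvector p T u)
    (u_pos : Kpp u)
    (rho_le1 : mx_spectral_radius (homogeneity_mx sigma p) <= 1)
    (x0_pos : Kpp x0)
    (y0_pos : Kpp y0) :
  let r := tspectral_radius sigma p T in
  let F := Fmap p T : bvec R (sdim sigma) -> bvec R (sdim sigma) in
  let G := Gmap p T : bvec R (sdim sigma) -> bvec R (sdim sigma) in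
  let rho := mx_spectral_radius (homogeneity_mx sigma p) in
  let x := power_iter p F x0 in
  let y := power_iter p G y0 in
  let xi_lo k := cw_lower p b F (x k) in
  let xi_hi k := cw_upper p b F (x k) in
  let zeta_lo k := cw_lower p b G (y k) ^+ 2 in
  let zeta_hi k := cw_upper p b G (y k) ^+ 2 in
  [/\ forall lo hi : nat -> R,
        (lo = xi_lo /\ hi = xi_hi) \/ (lo = zeta_lo /\ hi = zeta_hi) ->
        forall k : nat, (1 <= k)%N ->
          [/\ lo k <= lo k.+1, lo k.+1 <= r, r <= hi k.+1 & hi k.+1 <= hi k] /\
          (forall eps : R, 0 < eps -> hi k - lo k < eps ->
             `|(lo k + hi k) / 2 - r| <= eps / 2),
      rho < 1 ->
        (x @ \oo --> u) /\
        (forall k : nat, (1 <= k)%N ->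
           hilbert_metric b (x k) u <=
             hilbert_metric b (x 1%N) x0 / (1 - rho) * rho ^+ k)
    & weakly_irreducible sigma T -> y @ \oo --> u].
Proof.
move=> r F G rho x y xi_lo xi_hi zeta_lo zeta_hi.
have u0 : positive u by apply/KppE.
have x00 : positive x0 by apply/KppE.
have y00 : positive y0 by apply/KppE.
have [lambda lu] := u_eigen.
have pp := p_gt0 p p_gt1.
have u1 := eigen_normalized sigma p T lambda u lu.
have n0 := sdim_gt0 sigma p T p_gt1 lambda u lu.
have l0 := eigenvalue_gt0 sigma p T T_ge0 p_gt1 T_strict b bP lambda u lu u0.
have b0 := perron_gt0 sigma p b bP.
have g0 := ltW (gammaB1_gt0 sigma p p_gt1 b bP).
have rho0 : 0 <= rho := rho_ge0 sigma p p_gt1 b bP.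
have rE : r = lambda.
  exact: (tspectral_radius_eigen sigma p T T_ge0 p_gt1 T_strict b bP lambda u).
have FA := Fmap_multihomogeneous sigma p T T_ge0 p_gt1 T_strict.
have GA := mean_multihomogeneous _ _ FA.
have bA := perron_left sigma p b bP.
have bG := mean_left_eigen _ b _ bA.
have rhoG_le1 : 2^-1 * (1 + rho) <= 1 by move: rho_le1; rewrite -/rho; lra.
have Ft := Ftheta_gt0 sigma p T T_ge0 p_gt1 T_strict b bP lambda u lu u0.
have Gt i : 0 < Num.sqrt (Ftheta p lambda i) by rewrite sqrtr_gt0.
have Fu := Fmap_eigen sigma p T T_ge0 p_gt1 T_strict b bP lambda u lu u0.
have Gu := Gmap_eigen sigma p T T_ge0 p_gt1 T_strict b bP lambda u lu u0.
have cwF k := cw_sandwich n0 b b0 p pp _ F FA _ bA rho_le1 g0 u _ u0 u1 Ft Fu x0 k x00.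
have cwG k := cw_sandwich n0 b b0 p pp _ G GA _ bG rhoG_le1 g0 u _ u0 u1 Gt Gu y0 k y00.
have FL := Ftheta_sum sigma p p_gt1 b bP lambda.
have GL := Gtheta_sum sigma p T T_ge0 p_gt1 T_strict b bP lambda u lu u0.
split.
(* The bounds at k give the error estimate, those at k + 1 the chain. *)
- suff main (lo hi : nat -> R) : (forall k : nat, (1 <= k)%N ->
      [/\ lo k <= lo k.+1, lo k <= r, r <= hi k & hi k.+1 <= hi k]) ->
    forall k : nat, (1 <= k)%N ->
      [/\ lo k <= lo k.+1, lo k.+1 <= r, r <= hi k.+1 & hi k.+1 <= hi k] /\
      (forall eps : R, 0 < eps -> hi k - lo k < eps ->
         `|(lo k + hi k) / 2 - r| <= eps / 2).
    move=> lo hi [[-> ->]|[-> ->]]; apply: main => k k1.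
      have [c1 c2 c3 c4] := cwF k k1.
      rewrite FL lnK ?posrE// in c2 c3.
      by rewrite rE; split; [exact: c1|exact: c2|exact: c3|exact: c4].
    have [c1 c2 c3 c4] := cwG k k1.
    have lo0 z : 0 <= cw_lower p b G z by apply: prodr_ge0 => i _; exact: powR_ge0.
    have hi0 z : 0 <= cw_upper p b G z by apply: prodr_ge0 => i _; exact: powR_ge0.
    have sq s t : 0 <= s -> s <= t -> s ^+ 2 <= t ^+ 2 :> R.
      by move=> s0 st; rewrite ler_pXn2r// nnegrE (le_trans s0).
    rewrite rE -GL; split.
    - exact: (sq _ _ (lo0 _) c1).
    - exact: (sq _ _ (lo0 _) c2).
    - exact: (sq _ _ (expR_ge0 _) c3).
    - exact: (sq _ _ (hi0 _) c4).
  move=> h k k1; have [a1 a2 a3 a4] := h k k1; have [_ a5 a6 _] := h k.+1 isT.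
  split; first by split.
  move=> e e0 eP; rewrite ler_norml.
  by apply/andP; split; lra.
- move=> rho_lt1; split.
    exact: (contracting_iter_cvg n0 b b0 p pp _ F FA _ bA u _ u0 u1 Ft Fu rho0 rho_lt1 x0 x00).
  move=> k _.
  exact: (hilbert_iter n0 b b0 p pp _ F FA _ bA u _ u0 u1 Ft Fu rho0 rho_lt1 x0 k x00).
move=> T_irr; have [i0 _] := perron_index sigma p b bP.
have GS := mean_strict _ _ FA _ (Fmap_strict sigma p T T_ge0 p_gt1 T_strict).
apply: (irreducible_cvg n0 b b0 p pp _ G GA _ bG rhoG_le1 u _ u0 u1 Gt Gu _ _ _ GS i0 y0 y00).
  by move=> c; rewrite eqxx.
move=> S S0 ST; have [a [c [aS cS ac]]] := T_irr S S0 ST.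
by exists a, c; split=> //; rewrite ac orbT.
Qed.
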